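(* Let $H$ be a complex Hilbert space, let $e$ be a projection in $\mathcal{B}(H)$ of rank $\geq 2$ (possibly infinite), and let $E = \mathcal{B}(H)e$. Then $E$ is universally reversible, and its universal TRO is $T^*(E) = E \oplus E^t$ ($\ell_\infty$ sum) with universal embedding $\alpha_E(x) = x \oplus x^t$. It may be supposed (by choice of the conjugation defining the transposition) that $e^t = e$.
   Context: Given a conjugation $\xi\mapsto\bar\xi$ on $H$ (a conjugate-linear isometric involution), the transposition $x \mapsto x^t$ on $\mathcal{B}(H)$ is defined by $x^t(\xi) = \overline{x^*(\bar\xi)}$; $E^t = \{x^t : x \in E\}$. A TRO is a norm closed subspace of a $C^*$-algebra closed under $[a,b,c] = ab^*c$; a TRO homomorphism is a linear map preserving this product. A $JC^*$-triple is a complex Banach space $E$ linearly isometric to a norm closed subspace $F$ of a TRO closed under $\{a,b,c\} = \tfrac12(ab^*c + cb^*a)$; the triple product transported to $E$ is independent of the choice of $F$ and of the isometry. A triple homomorphism is a linear map preserving triple products. The universal TRO of a $JC^*$-triple $E$ is the pair $(T^*(E),\alpha_E)$, unique up to TRO isomorphism compatible with the embeddings, where $T^*(E)$ is a TRO, $\alpha_E \colon E \to T^*(E)$ is an injective triple homomorphism whose image generates $T^*(E)$ as a TRO, and for every triple homomorphism $\pi \colon E \to T$ into a TRO there is a unique TRO homomorphism $\tilde\pi \colon T^*(E) \to T$ with $\tilde\pi\circ\alpha_E = \pi$. $E$ is universally reversible if $\alpha_E(E)$ is reversible in $T^*(E)$, that is, $a_1 a_2^* a_3 \cdots a_{2n}^*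 a_{2n+1} + a_{2n+1} a_{2n}^* \cdots a_2^* a_1 \in \alpha_E(E)$ whenever $a_1, \ldots, a_{2n+1} \in \alpha_E(E)$ and $n\ge 1$. *)

(* Defs.v *)
From HB Require Import structures.
From mathcomp Require Import all_boot all_order all_algebra.
From mathcomp Require Import sesquilinear.
From mathcomp Require Import complex ring lra.
From mathcomp Require Import all_classical all_reals all_analysis.

Set Implicit Arguments.
Unset Strict Implicit.
Unset Printing Implicit Defensive.
Import Order.TTheory GRing.Theory Num.Theory.
Import numFieldNormedType.Exports.

Local Open Scope classical_set_scope.
Local Open Scope ring_scope.

(* The inner product is linear in the first variable and conjugate-linear in
   the second one; norms take their values in R[i], on the nonnegative reals *)
HB.mixin Record isHilbert (R : realType) H & CompleteNormedModule R[i] H := {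
  hdot : {dot H for @Num.conj R[i]};
  hdot_norm : forall x : H, hdot x x = `|x| ^+ 2
}.

#[short(type="hilbertType")]
HB.structure Definition Hilbert (R : realType) :=
  {H of isHilbert R H & CompleteNormedModule R[i] H}.

(* C*-algebras are not assumed to be unital *)
HB.mixin Record isCstarAlgebra (R : realType) A
    & CompleteNormedModule R[i] A := {
  cmul : A -> A -> A;
  cstar : A -> A;
  cmulA : associative cmul;
  cmul_linearl : forall b, linear (cmul^~ b);
  cmul_linearr : forall a, linear (cmul a);
  cstarK : involutive cstar;
  cstar_antilinear : forall (k : R[i]) a b,
    cstar (k *: a + b) = k^* *: cstar a + cstar b;
  cstarM : forall a b, cstar (cmul a b) = cmul (cstar b) (cstar a);
  cnormM : forall a b, `|cmul a b| <= `|a| * `|b|;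
  cnorm_star : forall a, `|cmul (cstar a) a| = `|a| ^+ 2
}.

#[short(type="cstarType")]
HB.structure Definition CstarAlgebra (R : realType) :=
  {A of isCstarAlgebra R A & CompleteNormedModule R[i] A}.

Section HilbertTheory.
Context {R : realType} {H : hilbertType R}.
Local Notation C := R[i].
Implicit Types x y z : H.

Lemma hdotDl x y z : hdot (x + y) z = hdot x z + hdot y z.
Proof. exact: linearDl. Qed.
Lemma hdotDr x y z : hdot z (x + y) = hdot z x + hdot z y.
Proof. exact: linearDr. Qed.
Lemma hdotBl x y z : hdot (x - y) z = hdot x z - hdot y z.
Proof. exact: linearBl. Qed.
Lemma hdotBr x y z : hdot z (x - y) = hdot z x - hdot z y.
Proof. exact: linearBr. Qed.
Lemma hdotZl (a : C) x y : hdot (a *: x) y = a * hdot x y.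
Proof. exact: linearZl_LR. Qed.
Lemma hdotZr (a : C) x y : hdot x (a *: y) = a^* * hdot x y.
Proof. exact: linearZr_LR. Qed.
Lemma hdotC x y : hdot x y = (hdot y x)^*.
Proof. by rewrite [LHS]hermitian_subproof expr0 mul1r. Qed.

Lemma hdot_inj y z : (forall x, hdot x y = hdot x z) -> y = z.
Proof.
move=> yz; apply/eqP; rewrite -subr_eq0 -normr_eq0 -sqrf_eq0 -hdot_norm.
by rewrite hdotBr yz subrr.
Qed.

Lemma hdot_CS x y : `|hdot x y| <= `|x| * `|y|.
Proof.
have [->|y0] := eqVneq y 0; first by
  rewrite -(scale0r (0 : H)) hdotZr rmorph0 mul0r scale0r !normr0 mulr0.
rewrite -(@ler_pXn2r _ 2%N) ?nnegrE ?mulr_ge0// exprMn.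
have n0 : 0 < `|y| ^+ 2 by rewrite exprn_gt0 ?normr_gt0.
have ny : (`|y| ^+ 2)^* = `|y| ^+ 2.
  by apply: conj_Creal; rewrite ger0_real ?exprn_ge0.
have : 0 <= `|(`|y| ^+ 2) *: x - hdot x y *: y| ^+ 2 by rewrite exprn_ge0.
rewrite -hdot_norm !hdotBl !hdotBr !hdotZl !hdotZr !hdot_norm ny.
rewrite (hdotC y x) normCK => h.
rewrite -subr_ge0 -(pmulr_rge0 _ n0).
rewrite (le_trans h)// le_eqVlt; apply/orP; left; apply/eqP; ring.
Qed.

Definition rnorm x : R := complex.Re `|x|.

Lemma rnormE x : `|x| = (rnorm x)%:C%C.
Proof.
have /ger0_Im : 0 <= `|x| by [].
by rewrite /rnorm; case: `|x| => a b /= ->.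
Qed.
End HilbertTheory.

Section Riesz.
Context {R : realType} {H : hilbertType R}.
Local Notation C := R[i].
Variables (f : H -> C) (K : C).
Hypothesis f_lin : forall (a : C) x y, f (a *: x + y) = a * f x + f y.
Hypothesis K0 : 0 <= K.
Hypothesis f_bnd : forall x, `|f x| <= K * `|x|.

Let fD x y : f (x + y) = f x + f y.
Proof. by rewrite -[x]scale1r f_lin mul1r scale1r. Qed.
Let fZ a x : f (a *: x) = a * f x.
Proof.
have f0 : f 0 = 0.
  have := fD 0 0; rewrite addr0 => /eqP.
  by rewrite addrC -subr_eq subrr => /eqP.
by rewrite -[a *: x]addr0 f_lin f0 addr0.
Qed.

Let Q x : C := `|x| ^+ 2 - (f x + (f x)^*).
Let q x : R := complex.Re (Q x).

Let addJ_real (a : C) : a + a^* \is Num.real.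
Proof. by rewrite CrealE rmorphD/= conjCK addrC. Qed.

Let QE x : Q x = (q x)%:C%C.
Proof.
by rewrite /q RRe_real// /Q rpredB ?addJ_real// ger0_real// exprn_ge0.
Qed.

Let Qlb x : - K ^+ 2 <= Q x.
Proof.
have h : f x + (f x)^* <= 2 * (K * `|x|).
  apply: (@le_trans _ _ `|f x + (f x)^*|); first by rewrite real_ler_norm.
  rewrite (le_trans (ler_normD _ _))// norm_conjC mulr_natl mulr2n.
  by rewrite lerD.
rewrite -subr_ge0 /Q.
have -> : `|x| ^+ 2 - (f x + (f x)^*) - - K ^+ 2 =
   (`|x| - K) ^+ 2 + (2 * (K * `|x|) - (f x + (f x)^*)) by ring.
rewrite addr_ge0 ?subr_ge0//.
by rewrite real_exprn_even_ge0// rpredB// ger0_real.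
Qed.

Let q_has_inf : has_inf (range q).
Proof.
split; first by exists (q 0), 0.
exists (- (complex.Re K) ^+ 2) => _ [x _ <-].
rewrite -lecR -QE rmorphN rmorphXn/= (_ : (complex.Re K)%:C%C = K)//.
by rewrite RRe_real// ger0_real.
Qed.

Let m := inf (range q).

Let q_ge x : m <= q x.
Proof. by apply: ge_inf; [case: q_has_inf | exists x]. Qed.

Let parallelogram x y :
  Q x + Q y - 2 * Q (2^-1 *: (x + y)) = 2^-1 * `|x - y| ^+ 2.
Proof.
have J2 : (2^-1 : C)^* = 2^-1 by rewrite conj_Creal// rpredV realn.
rewrite /Q -!hdot_norm !fZ !fD !hdotBl !hdotBr !hdotZl !hdotZr !hdotDl !hdotDr.
by rewrite !rmorphM !rmorphD/= J2; field.
Qed.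

Let variation x h (t : C) :
  Q (x + t *: h) = Q x - (t * (f h - hdot h x) + (t * (f h - hdot h x))^*)
     + t * t^* * `|h| ^+ 2.
Proof.
rewrite /Q -!hdot_norm !fD !fZ !hdotDl !hdotDr !hdotZl !hdotZr.
by rewrite (hdotC x h) !rmorphD !rmorphM !rmorphB/=; ring.
Qed.

Theorem riesz : exists z, forall x, f x = hdot x z.
Proof.
pose F := filter_from [set e : R | 0 < e] (fun e => [set x | q x < m + e]).
have FF : ProperFilter F.
  apply: filter_from_proper; first apply: filter_from_filter.
  - by exists 1 => /=.
  - move=> a b /= a0 b0; exists (Num.min a b) => /=; first by rewrite lt_min a0.
    move=> x /=; rewrite -ltrBlDl lt_min => /andP[].
    by rewrite !ltrBlDl; split.
  - move=> e /= e0; have [_ [x _ <-]] := inf_adherent e0 q_has_inf.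
    by exists x.
have /cauchy_cvg/cvg_ex[/= z Fz] : cauchy F.
  apply/cauchy_ballP => e e0 /=.
  have er : (complex.Re e)%:C%C = e by rewrite RRe_real// gtr0_real.
  have e'0 : 0 < (complex.Re e) ^+ 2 / 4.
    by rewrite divr_gt0// exprn_gt0// -ltcR er.
  near=> x y; rewrite -ball_normE /=.
  have qx : q x < m + (complex.Re e) ^+ 2 / 4.
    by near: x; exists ((complex.Re e) ^+ 2 / 4).
  have qy : q y < m + (complex.Re e) ^+ 2 / 4.
    by near: y; exists ((complex.Re e) ^+ 2 / 4).
  rewrite -(@ltr_pXn2r _ 2%N) ?nnegrE ?(ltW e0)//.
  have -> : `|x - y| ^+ 2 = 2 * (2^-1 * `|x - y| ^+ 2) by field.
  rewrite -parallelogram; set v := _ *: (x + y); rewrite !QE -[e]er.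
  rewrite -[2]/((2%:R) : C) -(rmorph_nat (real_complex R) 2).
  rewrite -!rmorphM -rmorphD -rmorphB -rmorphM -rmorphXn ltcR.
  have := q_ge v; lra.
exists z => h.
apply/eqP; rewrite -subr_eq0 -normr_eq0; apply/negP => /negP A0.
have {}A0 : 0 < `|f h - hdot h z| by rewrite lt_neqAle eq_sym A0/=.
pose c := 1 + `|h| ^+ 2 + `|h|.
have c0 : 0 < c by rewrite !ltr_wpDr ?exprn_ge0.
pose d := `|f h - hdot h z| / (2 * c).
have d0 : 0 < d by rewrite divr_gt0// mulr_gt0.
suff : `|f h - hdot h z| <= d * c.
  rewrite /d invfM mulrA mulfVK ?gt_eqF//.
  rewrite ler_pdivlMr// ger_pMr// => /le_lt_trans/(_ (ltr1n _ 2)).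
  by rewrite ltxx.
have dr : (complex.Re d)%:C%C = d by rewrite RRe_real// gtr0_real.
near F => x.
have qx : q x < m + (complex.Re d) ^+ 2.
  near: x; exists ((complex.Re d) ^+ 2) => //=.
  by rewrite exprn_gt0// -ltcR dr.
have xz : `|z - x| < d.
  near: x; apply: Fz; apply/nbhs_ballP; exists d => //= u.
  by rewrite -ball_normE.
have -> : f h - hdot h z = (f h - hdot h x) - hdot h (z - x).
  by rewrite hdotBr; ring.
rewrite (le_trans (ler_normB _ _))// /c mulrDr lerD//; last first.
  by rewrite (le_trans (hdot_CS _ _))// mulrC ler_wpM2r// ltW.
set w := f h - hdot h x.
pose s : C := (1 + `|h| ^+ 2)^-1.
have s1 : 0 < 1 + `|h| ^+ 2 by rewrite ltr_wpDr ?exprn_ge0.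
have s0 : 0 < s by rewrite invr_gt0.
have sJ : s^* = s by rewrite conj_Creal// gtr0_real.
have sh : s * `|h| ^+ 2 <= 1 by rewrite /s mulrC ler_pdivrMr// mul1r lerDr.
have : Q x < Q (x + (s * w^*) *: h) + d ^+ 2.
  rewrite !QE -dr -rmorphXn -rmorphD ltcR.
  by rewrite (lt_le_trans qx)// lerD2r.
rewrite variation -/w !rmorphM/= conjCK sJ => hw.
have {}hw : s * `|w| ^+ 2 <= d ^+ 2.
  rewrite ltW// (le_lt_trans _ (_ : s * `|w| ^+ 2 * (2 - s * `|h| ^+ 2) < _))//.
    by rewrite ler_peMr ?mulr_ge0 ?(ltW s0) ?exprn_ge0// lerBrDr
      -lerBrDl (le_trans sh)// -[2]/(1 + 1) addrK.
  rewrite -subr_gt0; move: hw; rewrite -subr_gt0; congr (0 < _).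
  by rewrite normCK; ring.
rewrite -(@ler_pXn2r _ 2%N) ?nnegrE ?mulr_ge0 ?(ltW d0) ?(ltW s1)//.
rewrite exprMn (@le_trans _ _ (d ^+ 2 * (1 + `|h| ^+ 2)))//.
  by rewrite -ler_pdivrMr// mulrC.
by rewrite ler_wpM2l ?exprn_ge0 ?(ltW d0)// ler_eXnr// lerDl exprn_ge0.
Unshelve. all: try by end_near.
by rewrite invr_ge0 mulr_ge0 ?(ltW c0). Qed.
End Riesz.

Section BoundedOperators.
Context {R : realType} (H : hilbertType R).
Local Notation C := R[i].

Definition bounded_linear : {pred (H -> H)} :=
  [pred f | `[< linear f /\ exists M : C, forall x, `|f x| <= M * `|x| >]].

Fact bounded_linear_submod_closed : submod_closed bounded_linear.
Proof.
split.
  apply/asboolP; split=> [a x y|]; first by rewrite scaler0 addr0.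
  by exists 0 => x; rewrite mul0r normr0.
move=> a f g /asboolP[fl [M fM]] /asboolP[gl [N gN]]; apply/asboolP; split.
  move=> k x y; rewrite /= -[LHS]/(a *: f (k *: x + y) + g (k *: x + y)).
  rewrite -[in RHS]/(a *: f x + g x) -[in RHS]/(a *: f y + g y) fl gl.
  by rewrite !scalerDr !scalerA (mulrC a k) addrACA.
exists (`|a| * M + N) => x; rewrite -[_ x]/(a *: f x + g x).
rewrite (le_trans (ler_normD _ _))// mulrDl lerD// normrZ -mulrA.
by rewrite ler_wpM2l.
Qed.

HB.instance Definition _ := GRing.isSubmodClosed.Build _ _ bounded_linear
  bounded_linear_submod_closed.

(* B(H) *)
Record bop := Bop { bop_fun :> H -> H; bop_prf : bop_fun \in bounded_linear }.

HB.instance Definition _ := [isSub for bop_fun].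
HB.instance Definition _ := [Choice of bop by <:].
HB.instance Definition _ := [SubChoice_isSubLmodule of bop by <:].

Implicit Types f g : bop.

Lemma bopP f g : (forall x, f x = g x) -> f = g.
Proof. by move=> fg; apply/val_inj/funext. Qed.

Lemma bopDE f g x : (f + g) x = f x + g x. Proof. by []. Qed.
Lemma bopNE f x : (- f) x = - f x. Proof. by []. Qed.
Lemma bopBE f g x : (f - g) x = f x - g x. Proof. by []. Qed.
Lemma bopZE (a : C) f x : (a *: f) x = a *: f x. Proof. by []. Qed.

Lemma bop_linear f : linear f.
Proof. by have /asboolP[] := bop_prf f. Qed.

Lemma bopD f x y : f (x + y) = f x + f y.
Proof. by rewrite -[x]scale1r bop_linear !scale1r. Qed.
Lemma bop0 f : f 0 = 0.
Proof. by apply: (addIr (f 0)); rewrite -bopD !add0r. Qed.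
Lemma bopZ f a x : f (a *: x) = a *: f x.
Proof. by rewrite -[a *: x]addr0 bop_linear bop0 addr0. Qed.

Definition opnorm f : C :=
  (sup [set rnorm (f x) | x in [set x | `|x| <= 1]])%:C%C.

Lemma bop_bounded f : exists2 M : C, 0 <= M & forall x, `|f x| <= M * `|x|.
Proof.
have /asboolP[_ [M fM]] := bop_prf f.
exists `|M| => // x; have := ger0_norm (le_trans (normr_ge0 _) (fM x)).
by rewrite normrM normr_id => ->.
Qed.

Let opset_has_sup f :
  has_sup [set rnorm (f x) | x in [set x | `|x| <= 1]].
Proof.
have [M M0 fM] := bop_bounded f.
split; first by exists (rnorm (f 0)), 0 => //=; rewrite normr0 ler01.
exists (complex.Re M) => _ [x /= x1 <-].
rewrite -lecR -rnormE RRe_real ?ger0_real//.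
by rewrite (le_trans (fM x))// ler_piMr.
Qed.

Lemma opnorm_ge f x : `|f x| <= opnorm f * `|x|.
Proof.
have [->|x0] := eqVneq x 0; first by rewrite bop0 !normr0 mulr0.
rewrite -ler_pdivrMr ?normr_gt0// mulrC -[`|x|]normr_id -normfV -normrZ -bopZ.
rewrite [`|f _|]rnormE /opnorm lecR; apply: (ub_le_sup (opset_has_sup f).2).
exists (`|x|^-1 *: x) => //=.
by rewrite normrZ normfV normr_id mulVf ?normr_eq0.
Qed.

Lemma opnorm_le f (M : C) : 0 <= M -> (forall x, `|f x| <= M * `|x|) ->
  opnorm f <= M.
Proof.
move=> M0 fM; have MR : (complex.Re M)%:C%C = M by rewrite RRe_real ?ger0_real.
rewrite /opnorm -MR lecR; apply: ge_sup; first exact: (opset_has_sup f).1.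
move=> _ [x /= x1 <-].
by rewrite -lecR MR -rnormE (le_trans (fM x))// ler_piMr.
Qed.

Lemma opnorm_ge0 f : 0 <= opnorm f.
Proof.
have h : rnorm (f 0) <= sup [set rnorm (f x) | x in [set x | `|x| <= 1]].
  by apply: (ub_le_sup (opset_has_sup f).2); exists 0; rewrite //= normr0.
rewrite /opnorm -[0]/((0 : R)%:C%C) lecR (le_trans _ h)//.
by rewrite -lecR -rnormE; exact: normr_ge0.
Qed.

Fact opnormD f g : opnorm (f + g) <= opnorm f + opnorm g.
Proof.
apply: opnorm_le => [|x]; first by rewrite addr_ge0 ?opnorm_ge0.
by rewrite bopDE (le_trans (ler_normD _ _))// mulrDl lerD ?opnorm_ge.
Qed.

Fact opnormZ (a : C) f : opnorm (a *: f) = `|a| * opnorm f.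
Proof.
have le b h : opnorm (b *: h) <= `|b| * opnorm h.
  apply: opnorm_le => [|x]; first by rewrite mulr_ge0 ?opnorm_ge0.
  by rewrite bopZE normrZ -mulrA ler_wpM2l ?opnorm_ge.
apply/le_anti; rewrite le/=; have [->|a0] := eqVneq a 0.
  by rewrite normr0 mul0r opnorm_ge0.
have := le a^-1 (a *: f).
by rewrite scalerA mulVf// scale1r normfV ler_pdivlMl ?normr_gt0.
Qed.

Fact opnorm0_eq0 f : opnorm f = 0 -> f = 0.
Proof.
move=> f0; apply: bopP => x; apply/eqP; rewrite -normr_le0.
by rewrite (le_trans (opnorm_ge _ _))// f0 mul0r.
Qed.

HB.instance Definition _ :=
  Lmodule_isNormed.Build C bop opnormD opnormZ opnorm0_eq0.

Lemma bop_normE f : `|f| = opnorm f. Proof. by []. Qed.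

Lemma bop_norm_ge f x : `|f x| <= `|f| * `|x|.
Proof. exact: opnorm_ge. Qed.

Lemma bop_norm_le f (M : C) : 0 <= M -> (forall x, `|f x| <= M * `|x|) ->
  `|f| <= M.
Proof. exact: opnorm_le. Qed.

Fact bop_complete (F : set_system bop) : ProperFilter F -> cauchy F -> cvg F.
Proof.
move=> FF /cauchyP Fc.
have cv x : cvg ((fun f : bop => f x) @ F).
  apply: cauchy_cvg; apply/cauchy_exP => e e0.
  have d0 : 0 < e / (1 + `|x|) by rewrite divr_gt0// ltr_wpDr.
  have [f Ff] := Fc _ d0; exists (f x).
  suff : F [set g : bop | ball (f x) e (g x)] by [].
  apply: filterS Ff => g.
  rewrite -!ball_normE /= => fg.
  rewrite -bopBE (le_lt_trans (bop_norm_ge _ _))//.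
  rewrite (@le_lt_trans _ _ (e / (1 + `|x|) * `|x|))//.
    by rewrite ler_wpM2r// ltW.
  by rewrite -mulrA gtr_pMr// mulrC ltr_pdivrMr ?ltr_wpDr// mul1r ltrDr.
pose L x := lim ((fun f : bop => f x) @ F).
have Llin : linear L.
  move=> a x y; have h := cv (a *: x + y).
  apply: (cvg_lim (@norm_hausdorff _ _)).
  rewrite (_ : (fun f : bop => f (a *: x + y)) = (fun f => a *: f x + f y)).
    by apply: cvgD; [apply: cvgZl_tmp|]; exact: cv.
  by apply/funext => f; rewrite bop_linear.
have key e : 0 < e -> exists2 h, F (ball h e) &
    forall x, `|h x - L x| <= e * `|x|.
  move=> e0; have [h Fh] := Fc _ e0; exists h => // x.
  apply/ler_addgt0Pr => d d0; near F => g.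
  have -> : h x - L x = (h - g) x - (L x - g x).
    by rewrite bopBE opprB addrA subrK.
  rewrite (le_trans (ler_normB _ _))// lerD//.
    rewrite (le_trans (bop_norm_ge _ _))// ler_wpM2r// ltW//.
    have : ball h e g by near: g.
    by rewrite -ball_normE.
  by rewrite ltW//; near: g; apply: cvgr_dist_lt d0; exact: cv.
have LP : L \in bounded_linear.
  apply/asboolP; split=> //.
  have [h _ hL] := key 1 ltr01; exists (`|h| + 1) => x.
  have -> : L x = h x - (h x - L x) by rewrite opprB addrC subrK.
  by rewrite (le_trans (ler_normB _ _))// mulrDl lerD// ?bop_norm_ge.
apply/cvg_ex; exists (Bop LP); apply/cvgrPdist_le => e e0.
have e20 : 0 < e / 2 by rewrite divr_gt0.
have [h Fh hL] := key _ e20; near=> f.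
have hf : `|h - f| < e / 2.
  have : ball h (e / 2) f by near: f.
  by rewrite -ball_normE.
apply: bop_norm_le => [|x]; first exact: ltW.
have -> : (Bop LP - f) x = (h - f) x - (h x - L x).
  by rewrite !bopBE /= opprB [RHS]addrC addrA subrK.
rewrite (le_trans (ler_normB _ _))// [e]splitr mulrDl lerD//.
by rewrite (le_trans (bop_norm_ge _ _))// ler_wpM2r// ltW.
Unshelve. all: by end_near. Qed.

HB.instance Definition _ := Uniform_isComplete.Build bop bop_complete.

End BoundedOperators.

Section OperatorAlgebra.
Context {R : realType} (H : hilbertType R).
Local Notation C := R[i].
Implicit Types f g : bop H.

Fact bop_comp_bounded f g : f \o g \in @bounded_linear R H.
Proof.
apply/asboolP; split=> [a x y|]; first by rewrite /= !bop_linear.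
exists (`|f| * `|g|) => x; rewrite (le_trans (bop_norm_ge _ _))//= -mulrA.
by rewrite ler_wpM2l ?bop_norm_ge.
Qed.

Definition bop_comp f g : bop H := Bop (bop_comp_bounded f g).

Fact bop_adjoint_subproof f :
  {g : bop H | forall x y, hdot (f x) y = hdot x (g y)}.
Proof.
apply: cid.
have h y : exists z, forall x, hdot (f x) y = hdot x z.
  apply: (@riesz _ _ _ (`|f| * `|y|)) => [a x z||x].
  - by rewrite bop_linear hdotDl hdotZl.
  - by rewrite mulr_ge0.
  - by rewrite (le_trans (hdot_CS _ _))// mulrAC ler_wpM2r// bop_norm_ge.
pose g y := sval (cid (h y)).
have gE x y : hdot (f x) y = hdot x (g y) by rewrite /g; case: cid.
have gP : g \in @bounded_linear R H.
  apply/asboolP; split=> [a x y|].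
    by apply: hdot_inj => z; rewrite -gE !hdotDr !hdotZr !gE.
  exists `|f| => y; have [->|y0] := eqVneq (g y) 0.
    by rewrite normr0 mulr_ge0.
  rewrite -(@ler_pM2r _ `|g y|) ?normr_gt0// -expr2 -hdot_norm -gE.
  rewrite -[leLHS]ger0_norm; last by rewrite gE hdot_norm exprn_ge0.
  by rewrite (le_trans (hdot_CS _ _))// mulrAC ler_wpM2r// bop_norm_ge.
by exists (Bop gP).
Qed.

Definition adjoint f : bop H := sval (bop_adjoint_subproof f).

Lemma adjointE f x y : hdot (f x) y = hdot x (adjoint f y).
Proof. by rewrite /adjoint; case: bop_adjoint_subproof. Qed.

Lemma adjointE' f x y : hdot (adjoint f x) y = hdot x (f y).
Proof. by rewrite hdotC -adjointE -hdotC. Qed.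

Fact bop_compA : associative bop_comp.
Proof. by move=> f g h; exact: bopP. Qed.

Fact bop_comp_linearl g : linear (bop_comp^~ g).
Proof. by move=> a f f'; exact: bopP. Qed.

Fact bop_comp_linearr f : linear (bop_comp f).
Proof. by move=> a g g'; apply: bopP => x; rewrite /= bop_linear. Qed.

Fact adjointK : involutive adjoint.
Proof.
move=> f; apply: bopP => x; apply: hdot_inj => y.
by rewrite -adjointE adjointE'.
Qed.

Fact adjoint_antilinear (a : C) f g :
  adjoint (a *: f + g) = a^* *: adjoint f + adjoint g.
Proof.
apply: bopP => x; apply: hdot_inj => y.
by rewrite -adjointE !bopDE !bopZE hdotDl hdotDr hdotZl hdotZr conjCK !adjointE.
Qed.

Fact adjoint_comp f g :
  adjoint (bop_comp f g) = bop_comp (adjoint g) (adjoint f).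
Proof.
by apply: bopP => x; apply: hdot_inj => y; rewrite -adjointE /= !adjointE.
Qed.

Fact bop_normM f g : `|bop_comp f g| <= `|f| * `|g|.
Proof.
apply: bop_norm_le => [|x]; first by rewrite mulr_ge0.
rewrite (le_trans (bop_norm_ge f (g x)))// -mulrA.
by rewrite ler_wpM2l ?bop_norm_ge.
Qed.

Let adjoint_norm_le f : `|adjoint f| <= `|f|.
Proof.
apply: bop_norm_le => // y; have [->|y0] := eqVneq (adjoint f y) 0.
  by rewrite normr0 mulr_ge0.
rewrite -(@ler_pM2r _ `|adjoint f y|) ?normr_gt0// -expr2 -hdot_norm -adjointE.
rewrite -[leLHS]ger0_norm; last by rewrite adjointE hdot_norm exprn_ge0.
by rewrite (le_trans (hdot_CS _ _))// mulrAC ler_wpM2r// bop_norm_ge.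
Qed.

Fact bop_norm_star f : `|bop_comp (adjoint f) f| = `|f| ^+ 2.
Proof.
apply/le_anti/andP; split.
  by rewrite (le_trans (bop_normM _ _))// expr2 ler_wpM2r.
set K := `|bop_comp _ _|.
suff h : `|f| <= sqrtC K.
  have fn : `|f| \is Num.nneg by rewrite nnegrE; exact: normr_ge0.
  have Kn : sqrtC K \is Num.nneg by rewrite nnegrE sqrtC_ge0; exact: normr_ge0.
  by rewrite -[K]sqrtCK (ler_pXn2r (ltn0Sn 1) fn Kn).
apply: bop_norm_le => [|x]; first by rewrite sqrtC_ge0 normr_ge0.
rewrite -(@ler_pXn2r _ 2%N) ?nnegrE ?mulr_ge0 ?sqrtC_ge0 ?normr_ge0//.
rewrite exprMn sqrtCK -hdot_norm -adjointE'.
rewrite -[leLHS]ger0_norm; last by rewrite adjointE' hdot_norm exprn_ge0.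
rewrite (le_trans (hdot_CS _ _))// expr2 mulrA ler_wpM2r//.
by rewrite (bop_norm_ge (bop_comp (adjoint f) f)).
Qed.

HB.instance Definition _ := isCstarAlgebra.Build R (bop H) bop_compA
  bop_comp_linearl bop_comp_linearr adjointK adjoint_antilinear adjoint_comp
  bop_normM bop_norm_star.

End OperatorAlgebra.


Section ProdComplete.
Context {K : numFieldType} {U V : completeNormedModType K}.

HB.instance Definition _ := Uniform.on (U * V)%type.

Fact prod_complete (F : set_system (U * V)%type) :
  ProperFilter F -> cauchy F -> cvg F.
Proof.
move=> FF /cauchyP Fc.
have /cvg_ex[/= a Fa] : cvg ((fst : U * V -> U) @ F).
  apply: cauchy_cvg; apply/cauchy_exP => e /Fc[u Fu]; exists u.1.
  suff : F [set v | ball u.1 e v.1] by [].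
  by apply: filterS Fu => v [].
have /cvg_ex[/= b Fb] : cvg ((snd : U * V -> V) @ F).
  apply: cauchy_cvg; apply/cauchy_exP => e /Fc[u Fu]; exists u.2.
  suff : F [set v | ball u.2 e v.2] by [].
  by apply: filterS Fu => v [].
apply/cvg_ex; exists (a, b); apply/cvg_ballP => e e0.
have ha : F [set v | ball a e v.1].
  by apply: (Fa (ball a e)); exact: nbhsx_ballx.
have hb : F [set v | ball b e v.2].
  by apply: (Fb (ball b e)); exact: nbhsx_ballx.
by apply: filterS (filterI ha hb) => v [].
Qed.

HB.instance Definition _ := Uniform_isComplete.Build (U * V)%type prod_complete.

End ProdComplete.

(* The l_infty direct sum: the norm on products is the maximum norm *)
Section DirectSum.
Context {R : realType} {A B : cstarType R}.
Local Notation C := R[i].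
Local Notation AB := (A * B)%type.
Implicit Types u v : AB.

Definition prod_mul u v : AB := (cmul u.1 v.1, cmul u.2 v.2).
Definition prod_star u : AB := (cstar u.1, cstar u.2).

Fact prod_mulA : associative prod_mul.
Proof. by move=> u v w; rewrite /prod_mul /= !cmulA. Qed.

Fact prod_mul_linearl v : linear (prod_mul^~ v).
Proof. by move=> a u w; congr pair; rewrite /= cmul_linearl. Qed.

Fact prod_mul_linearr u : linear (prod_mul u).
Proof. by move=> a v w; congr pair; rewrite /= cmul_linearr. Qed.

Fact prod_starK : involutive prod_star.
Proof. by move=> [a b]; rewrite /prod_star /= !cstarK. Qed.

Fact prod_star_antilinear (a : C) u v :
  prod_star (a *: u + v) = a^* *: prod_star u + prod_star v.
Proof. by congr pair; rewrite /= cstar_antilinear. Qed.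

Fact prod_starM u v :
  prod_star (prod_mul u v) = prod_mul (prod_star v) (prod_star u).
Proof. by congr pair; rewrite /= cstarM. Qed.

Fact prod_normM u v : `|prod_mul u v| <= `|u| * `|v|.
Proof.
rewrite !prod_normE /=.
have le_max (a b : C) : 0 <= a -> 0 <= b ->
    (a <= Num.max a b) /\ (b <= Num.max a b).
  move=> a0 b0; have /orP[h|h] : (a <= b) || (b <= a).
    by rewrite real_leVge ?ger0_real.
  - by rewrite max_r.
  - by rewrite max_l.
have [u1 u2] := le_max _ _ (normr_ge0 u.1) (normr_ge0 u.2).
have [v1 v2] := le_max _ _ (normr_ge0 v.1) (normr_ge0 v.2).
rewrite comparable_ge_max ?real_comparable ?ger0_real//.
by apply/andP; split; rewrite (le_trans (cnormM _ _))// ler_pM.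
Qed.

Fact prod_norm_star u : `|prod_mul (prod_star u) u| = `|u| ^+ 2.
Proof.
rewrite !prod_normE /= !cnorm_star.
have /orP[h|h] : (`|u.1| <= `|u.2|) || (`|u.2| <= `|u.1|).
  by rewrite real_leVge ?ger0_real.
- have h2 : `|u.1| ^+ 2 <= `|u.2| ^+ 2 by rewrite ler_pXn2r ?nnegrE.
  by rewrite (max_r h) (max_r h2).
- have h2 : `|u.2| ^+ 2 <= `|u.1| ^+ 2 by rewrite ler_pXn2r ?nnegrE.
  by rewrite (max_l h) (max_l h2).
Qed.

HB.instance Definition _ := isCstarAlgebra.Build R AB prod_mulA
  prod_mul_linearl prod_mul_linearr prod_starK prod_star_antilinear prod_starM
  prod_normM prod_norm_star.

End DirectSum.

Record conjugation (R : realType) (H : hilbertType R) := Conjugation {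
  conj_fun :> H -> H;
  conj_antilinear : forall (a : R[i]) x y,
    conj_fun (a *: x + y) = a^* *: conj_fun x + conj_fun y;
  conj_isometry : forall x, `|conj_fun x| = `|x|;
  conj_involutive : involutive conj_fun
}.

Section Transposition.
Context {R : realType} {H : hilbertType R} (J : conjugation H).

Fact transp_subproof (x : bop H) :
  (fun xi => J (cstar x (J xi))) \in @bounded_linear R H.
Proof.
apply/asboolP; split=> [a u v|].
  by rewrite conj_antilinear bop_linear conj_antilinear conjCK.
exists `|cstar x| => u.
by rewrite conj_isometry -(conj_isometry J u) bop_norm_ge.
Qed.

(* x^t xi = J (x^* (J xi)), where J is the conjugation xi |-> \bar xi *)
Definition transp (x : bop H) : bop H := Bop (transp_subproof x).

End Transposition.

Section Operators.
Context {R : realType} {H : hilbertType R}.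

Definition is_projection (e : bop H) : Prop := cmul e e = e /\ cstar e = e.

(* the range of e contains two linearly independent vectors *)
Definition rank_ge2 (e : bop H) : Prop :=
  exists x y : H, forall a b : R[i],
    a *: e x + b *: e y = 0 -> a = 0 /\ b = 0.

End Operators.

Section Triples.
Context {R : realType} {A : cstarType R}.
Implicit Types (a b c : A) (S : set A).

Definition tro_prod a b c : A := cmul (cmul a (cstar b)) c.

Definition jc_prod a b c : A := 2^-1 *: (tro_prod a b c + tro_prod c b a).

Definition is_subspace S : Prop :=
  S 0 /\ forall (k : R[i]) x y, S x -> S y -> S (k *: x + y).

Definition closed_under (op : A -> A -> A -> A) S : Prop :=
  forall a b c, S a -> S b -> S c -> S (op a b c).

Definition is_TRO S : Prop :=
  [/\ closed S, is_subspace S & closed_under tro_prod S].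

(* JC*-triples are taken in their concrete form; since A is itself a TRO, the
   norm closed subspaces of TROs in A are those of A *)
Definition is_JCtriple S : Prop :=
  [/\ closed S, is_subspace S & closed_under jc_prod S].

(* a 0 (a 1)^* (a 2) ... (a (2n-1))^* (a (2n)) *)
Fixpoint odd_word (a : nat -> A) (n : nat) : A :=
  if n is m.+1 then tro_prod (odd_word a m) (a m.*2.+1) (a m.*2.+2) else a 0%N.

Definition reversible S : Prop := forall (n : nat) (a : nat -> A),
  (0 < n)%N -> (forall i, (i <= n.*2)%N -> S (a i)) ->
  S (odd_word a n + odd_word (fun i => a (n.*2 - i)%N) n).

End Triples.

Section Morphisms.
Context {R : realType} {A B : cstarType R}.
Implicit Types (E : set A) (T : set B) (f : A -> B).

(* Maps defined on E are represented by total functions, constrained on E *)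
Definition linear_on E f : Prop := forall (k : R[i]) x y,
  E x -> E y -> f (k *: x + y) = k *: f x + f y.

Definition triple_hom E T f : Prop :=
  [/\ forall x, E x -> T (f x), linear_on E f &
      forall a b c, E a -> E b -> E c ->
        f (jc_prod a b c) = jc_prod (f a) (f b) (f c)].

Definition TRO_hom E T f : Prop :=
  [/\ forall x, E x -> T (f x), linear_on E f &
      forall a b c, E a -> E b -> E c ->
        f (tro_prod a b c) = tro_prod (f a) (f b) (f c)].

End Morphisms.

Section UniversalTRO.
Context {R : realType} {A : cstarType R}.

Record is_universal_TRO {B : cstarType R} (E : set A) (T : set B)
    (alpha : A -> B) : Prop := {
  universal_JCtriple : is_JCtriple E;
  universal_TRO : is_TRO T;
  universal_hom : triple_hom E T alpha;
  universal_inj : set_inj E alpha;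
  universal_generates : smallest is_TRO (alpha @` E) = T;
  universal_property : forall (C : cstarType R) (U : set C) (pi : A -> C),
    is_TRO U -> triple_hom E U pi ->
    exists g : B -> C,
      [/\ TRO_hom T U g, forall x, E x -> g (alpha x) = pi x &
          forall h : B -> C, TRO_hom T U h ->
            (forall x, E x -> h (alpha x) = pi x) ->
            forall t, T t -> h t = g t]
}.

(* the universal TRO is unique up to an isomorphism compatible with the
   embeddings, so it does not matter which one is used here *)
Definition universally_reversible (E : set A) : Prop :=
  forall (B : cstarType R) (T : set B) (alpha : A -> B),
    is_universal_TRO E T alpha -> reversible (alpha @` E).

End UniversalTRO.

(* Main.v *)
Require Import Defs.
From mathcomp Require Import all_boot all_order all_algebra.
From mathcomp Require Import complex ring lra.
From mathcomp Require Import all_classical all_reals all_analysis.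

(* A maximality argument writes e = p + q + r with p, q, r orthogonal
   projections, p and q equivalent and r of rank at most one, dominated by p;
   so e is a finite orthogonal sum of projections p_i, each carried by a partial
   isometry s_i into some p_(j i) orthogonal to p_i.  The elements (x, 0) and
   (0, x^t) of E + E^t are then sums of triple products of elements (y, y^t),
   since y_i = x s_i^* satisfies
     x = sum_i y_i p_(j i)^* s_i   and   s_i p_(j i)^* y_i = 0.
   Given a triple homomorphism f on E, the same sums written with f split f as
   phi + psi, where phi x = f x Z and psi x = Y f x for projections Z and Y with
   Y f(x) Z = 0.  A Peirce calculus for the tripotents f p_i and f s_i shows that
   phi is a TRO homomorphism and psi a TRO antihomomorphism, with orthogonal
   ranges; so (x, y^t) |-> phi x + psi y is the required extension, and it is
   the only one by the formulas for (x, 0) and (0, x^t). *)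

Set Implicit Arguments.
Unset Strict Implicit.
Unset Printing Implicit Defensive.
Import Order.TTheory GRing.Theory Num.Theory.
Import numFieldNormedType.Exports.
Local Open Scope classical_set_scope.
Local Open Scope ring_scope.

(** * *-algebras *)

(** A triple homomorphism f respects only the symmetrised product a b^* c + c b^* a, so a single
    word can be carried through f only when its reverse vanishes. This is what a partner orthogonal
    to each p_i provides, and where rank at least two enters: a projection of rank one leaves no
    room for a partner. The decomposition of e has to be finite, since f is merely linear and cannot
    be taken through the strongly convergent sums that a family of rank-one projections would
    produce when e has infinite rank. The projections Z and Y are polynomials in the f p_i, the f
    s_i and their adjoints. They therefore exist in the target C*-algebra itself, with no unit,
    bidual or polar decomposition: the part of f s_i that is cut out is already a partial isometry,
    because its two halves have orthogonal supports. *)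

Section CstarTheory.
Context {R : realType} {A : cstarType R}.
Implicit Types a b c : A.

Lemma cmulDl a b c : cmul (a + b) c = cmul a c + cmul b c.
Proof. by have := cmul_linearl c 1 a b; rewrite !scale1r. Qed.
Lemma cmulDr a b c : cmul a (b + c) = cmul a b + cmul a c.
Proof. by have := cmul_linearr a 1 b c; rewrite !scale1r. Qed.
Lemma cmul0l b : cmul 0 b = 0.
Proof. by apply: (addIr (cmul 0 b)); rewrite -cmulDl !add0r. Qed.
Lemma cmul0r b : cmul b 0 = 0.
Proof. by apply: (addIr (cmul b 0)); rewrite -cmulDr !add0r. Qed.
Lemma cmulZl k a b : cmul (k *: a) b = k *: cmul a b.
Proof. by have := cmul_linearl b k a 0; rewrite cmul0l !addr0. Qed.
Lemma cmulZr k a b : cmul a (k *: b) = k *: cmul a b.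
Proof. by have := cmul_linearr a k b 0; rewrite cmul0r !addr0. Qed.
Lemma cmulNl a b : cmul (- a) b = - cmul a b.
Proof. by rewrite -scaleN1r cmulZl scaleN1r. Qed.
Lemma cmulNr a b : cmul a (- b) = - cmul a b.
Proof. by rewrite -scaleN1r cmulZr scaleN1r. Qed.
Lemma cmul_suml (I : finType) (F : I -> A) b :
  cmul (\sum_i F i) b = \sum_i cmul (F i) b.
Proof.
apply: (big_morph (fun a => cmul a b)) => [x y|]; first exact: cmulDl.
exact: cmul0l.
Qed.
Lemma cmul_sumr (I : finType) (F : I -> A) b :
  cmul b (\sum_i F i) = \sum_i cmul b (F i).
Proof.
apply: (big_morph (cmul b)) => [x y|]; first exact: cmulDr.
exact: cmul0r.
Qed.
Lemma cstarD a b : cstar (a + b) = cstar a + cstar b.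
Proof. by have := cstar_antilinear 1 a b; rewrite rmorph1 !scale1r. Qed.
Lemma cstar0 : cstar (0 : A) = 0.
Proof. by apply: (addIr (cstar 0)); rewrite -cstarD !add0r. Qed.
Lemma cstarZ k a : cstar (k *: a) = k^* *: cstar a.
Proof. by have := cstar_antilinear k a 0; rewrite cstar0 !addr0. Qed.
Lemma cstarN a : cstar (- a) = - cstar a.
Proof. by rewrite -scaleN1r cstarZ rmorphN rmorph1 scaleN1r. Qed.

Lemma double_eq0 a : a + a = 0 -> a = 0.
Proof.
rewrite -mulr2n -scaler_nat => /eqP.
by rewrite scaler_eq0 pnatr_eq0 => /eqP.
Qed.

End CstarTheory.

(** * Grids of partial isometries *)

Section Grid.
Context {R : realType} {A : cstarType R}.

(** Only the initial projection of [s i] is prescribed; its range may be smaller than that of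
    [p (j i)]. This lets a remainder of rank one be linked to a projection of any larger rank. *)
Record grid (e : A) (I : finType) (p s : I -> A) (j : I -> I) : Prop := Grid {
  grid_neq : forall i, j i != i;
  grid_star : forall i, cstar (p i) = p i;
  grid_idem : forall i, cmul (p i) (p i) = p i;
  grid_orth : forall i k, i != k -> cmul (p i) (p k) = 0;
  grid_sum : \sum_i p i = e;
  grid_l : forall i, cmul (p (j i)) (s i) = s i;
  grid_r : forall i, cmul (s i) (p i) = s i;
  grid_ss : forall i, cmul (cstar (s i)) (s i) = p i
}.

End Grid.

(* Only the *-ring structure of the target matters below.  Keeping the product
   abstract lets every one-sided statement be applied to the opposite product. *)
Section StarRing.
Context {V : zmodType}.

Record star_ring (m : V -> V -> V) (st : V -> V) : Prop := StarRing {
  srA : associative m;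
  srDl : left_distributive m +%R;
  srDr : right_distributive m +%R;
  srK : involutive st;
  srD : {morph st : x y / x + y};
  srM : forall a b, st (m a b) = m (st b) (st a);
  sr2 : forall x : V, x + x = 0 -> x = 0
}.

Lemma star_ring_flip m st : star_ring m st -> star_ring (fun a b => m b a) st.
Proof.
by move=> [mA mDl mDr stK stD stM V2]; split=> // a b c /=.
Qed.

Variables (m : V -> V -> V) (st : V -> V).
Hypothesis SR : star_ring m st.
Local Notation "x ## y" := (m x y) (at level 40, left associativity).
Implicit Types (t n z u v : V).

Lemma sr0l z : 0 ## z = 0.
Proof. by apply: (addIr (0 ## z)); rewrite -(srDl SR) !add0r. Qed.
Lemma sr0r z : z ## 0 = 0.
Proof. by apply: (addIr (z ## 0)); rewrite -(srDr SR) !add0r. Qed.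
Lemma sr_star0 : st 0 = 0.
Proof. by apply: (addIr (st 0)); rewrite -(srD SR) !add0r. Qed.
Lemma sr_suml (I : finType) (F : I -> V) t :
  (\sum_i F i) ## t = \sum_i F i ## t.
Proof. by apply: (big_morph (m^~ t)) => [x y|]; rewrite ?(srDl SR) ?sr0l. Qed.
Lemma sr_sumr (I : finType) (F : I -> V) t :
  t ## (\sum_i F i) = \sum_i t ## F i.
Proof. by apply: (big_morph (m t)) => [x y|]; rewrite ?(srDr SR) ?sr0r. Qed.
Lemma sr_star_sum (I : finType) (F : I -> V) :
  st (\sum_i F i) = \sum_i st (F i).
Proof. by apply: big_morph => [x y|]; rewrite ?(srD SR) ?sr_star0. Qed.

Lemma sr_kill a b x y : a ## b = 0 -> x ## a ## (b ## y) = 0.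
Proof. by move=> ab; rewrite -(srA SR) ((srA SR) a) ab sr0l sr0r. Qed.

Lemma sr_killl a b y : a ## b = 0 -> a ## (b ## y) = 0.
Proof. by move=> ab; rewrite (srA SR) ab sr0l. Qed.

Lemma sr_half_inj u v : u + u = v + v -> u = v.
Proof.
move=> uv; apply/subr0_eq/(sr2 SR).
by rewrite addrACA uv -opprD subrr.
Qed.

(** Multiplying by n on the left and by z on the right gives n t = - n t z = t z, so the sum is
    twice either term. This is how one-sided identities are extracted from symmetrised ones. *)
Lemma idem_sum_eq0 n t z : n ## n = n -> z ## z = z ->
  n ## t + t ## z = 0 -> n ## t = 0 /\ t ## z = 0.
Proof.
move=> nn zz h.
have h1 : n ## t + n ## t ## z = 0.
  by rewrite -[X in X ## t + _]nn -!(srA SR) -(srDr SR) h sr0r.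
have h2 : n ## t ## z + t ## z = 0.
  by rewrite -[X in _ + t ## X]zz (srA SR) -(srDl SR) h sr0l.
have e1 : n ## t = t ## z.
  by apply: (addIr (n ## t ## z)); rewrite h1 addrC h2.
rewrite -e1; suff -> : n ## t = 0 by [].
by apply: (sr2 SR); rewrite {2}e1.
Qed.

End StarRing.

(** * Splitting a Jordan homomorphism along a grid *)

Section Decomposition.
Context {R : realType} {A : cstarType R} {V : zmodType}.

Local Notation "x ** y" := (cmul x y) (at level 40, left associativity).

(** The triple product is doubled and linearity reduced to additivity because the target has no
    scalars. *)
Record jordan_hom (e : A) (m : V -> V -> V) (st : V -> V) (f : A -> V) : Prop :=
  JordanHom {
  jhD : forall a b, a ** e = a -> b ** e = b -> f (a + b) = f a + f b;
  jhJ : forall a b c, a ** e = a -> b ** e = b -> c ** e = c ->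
    m (m (f a) (st (f b))) (f c) + m (m (f c) (st (f b))) (f a) =
    f (tro_prod a b c + tro_prod c b a)
}.

Lemma jordan_hom_flip e m st f : star_ring m st -> jordan_hom e m st f ->
  jordan_hom e (fun a b => m b a) st f.
Proof.
move=> SR [fD fJ]; split=> // a b c Ea Eb Ec /=.
by rewrite addrC -fJ// !(srA SR).
Qed.

(* For u = f (p i) and v = f (s i) these are v r and r v^* v r, where r = u^* u
   is the right support of u: the part of v on which f acts as a TRO
   homomorphism, and its right support. *)
Definition sr_cut (m : V -> V -> V) (st : V -> V) (u v : V) :=
  m v (m (st u) u).
Definition sr_supp (m : V -> V -> V) (st : V -> V) (u v : V) :=
  m (st (sr_cut m st u v)) (sr_cut m st u v).

Variables (e : A) (I : finType) (p s : I -> A) (j : I -> I).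
Hypothesis G : grid e p s j.

Lemma gridpe i : p i ** e = p i.
Proof.
rewrite -(grid_sum G) cmul_sumr (bigD1 i)//= (grid_idem G) big1 ?addr0// => k ki.
by rewrite (grid_orth G)// eq_sym.
Qed.
Lemma gridE i x : x ** p i = x -> x ** e = x.
Proof. by move=> <-; rewrite -cmulA gridpe. Qed.
Lemma gridse i : s i ** e = s i.
Proof. exact/gridE/grid_r/G. Qed.
Lemma gridEM a x : x ** e = x -> (a ** x) ** e = a ** x.
Proof. by rewrite -cmulA => ->. Qed.
Lemma gridK i a : a ** p i ** p i = a ** p i.
Proof. by rewrite -cmulA (grid_idem G). Qed.
Lemma grid_orthr i k x : i != k -> x ** p i = x -> x ** p k = 0.
Proof. by move=> ik <-; rewrite -cmulA (grid_orth G)// cmul0r. Qed.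
Lemma grid_orthl i k x : i != k -> p i ** x = x -> p k ** x = 0.
Proof. by move=> ik <-; rewrite cmulA (grid_orth G) ?cmul0l// eq_sym. Qed.
Lemma grid_starl i : p i ** cstar (s i) = cstar (s i).
Proof. by rewrite -{1}(grid_star G) -cstarM (grid_r G). Qed.
Lemma grid_starr i : cstar (s i) ** p (j i) = cstar (s i).
Proof. by rewrite -{1}(grid_star G) -cstarM (grid_l G). Qed.
Lemma grid_split x : x ** e = x -> x = \sum_i x ** p i.
Proof. by move=> Ex; rewrite -{1}Ex -(grid_sum G) cmul_sumr. Qed.

Section OneSided.
Variables (m : V -> V -> V) (st : V -> V) (f : A -> V).
Hypothesis SR : star_ring m st.
Hypothesis JF : jordan_hom e m st f.

Local Notation "x ## y" := (m x y) (at level 40, left associativity).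
Local Notation E x := (x ** e = x).
Local Notation P i := (f (p i)).
Local Notation S i := (f (s i)).
Local Notation l i := (P i ## st (P i)).
Local Notation r i := (st (P i) ## P i).
Local Notation z i := (sr_supp m st (P i) (S i)).
Local Notation mA := (srA SR).

Let E0 : E (0 : A).
Proof. exact: cmul0l. Qed.

Lemma jh0 : f 0 = 0.
Proof. by apply: (addIr (f 0)); rewrite -(jhD JF)// !add0r. Qed.

Lemma jh_sum (J : finType) (F : J -> A) : (forall i, E (F i)) ->
  f (\sum_i F i) = \sum_i f (F i).
Proof.
move=> EF; suff : E (\sum_i F i) /\ f (\sum_i F i) = \sum_i f (F i) by case.
elim/big_rec2 : _ => [|i x y _ [Ey fy]]; first by rewrite jh0.
by split; [rewrite cmulDl EF Ey|rewrite (jhD JF)// fy].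
Qed.

Lemma jh_tripotent a : E a -> tro_prod a a a = a ->
  f a ## st (f a) ## f a = f a.
Proof.
move=> Ea aaa; apply: (sr_half_inj SR).
by rewrite (jhJ JF)// aaa (jhD JF).
Qed.

Lemma gridPPP i : P i ## st (P i) ## P i = P i.
Proof.
by apply: jh_tripotent; rewrite ?gridpe// /tro_prod (grid_star G) !(grid_idem G).
Qed.
Lemma gridSSS i : S i ## st (S i) ## S i = S i.
Proof.
apply: jh_tripotent; rewrite ?gridse// /tro_prod -cmulA (grid_ss G).
exact: grid_r G i.
Qed.
Lemma gridPPPs i : st (P i) ## P i ## st (P i) = st (P i).
Proof. by rewrite -[in RHS]gridPPP !(srM SR) (srK SR) mA. Qed.
Lemma gridll i : l i ## l i = l i.
Proof. by rewrite mA gridPPP. Qed.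
Lemma gridrr i : r i ## r i = r i.
Proof. by rewrite mA gridPPPs. Qed.
Lemma gridlst i : st (l i) = l i.
Proof. by rewrite (srM SR) (srK SR). Qed.
Lemma gridrst i : st (r i) = r i.
Proof. by rewrite (srM SR) (srK SR). Qed.

(** The image of the triple product of [p i], [p i], [x]. Here [l i] and [r i] are the left and
    right supports of the partial isometry [f (p i)]. *)
Lemma jh_peirce i x : E x -> l i ## f x + f x ## r i = f (p i ** x + x ** p i).
Proof.
move=> Ex; have := jhJ JF (gridpe i) (gridpe i) Ex.
rewrite /tro_prod (grid_star G) (grid_idem G) mA => ->.
by rewrite -cmulA (grid_idem G).
Qed.

Lemma jh_peirce2 i x : E x -> p i ** x ** p i = 0 -> l i ## f x ## r i = 0.
Proof.
move=> Ex px; have := jhJ JF (gridpe i) Ex (gridpe i).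
have -> : tro_prod (p i) x (p i) = 0.
  rewrite /tro_prod -[RHS]cstar0 -px !cstarM (grid_star G).
  by rewrite cmulA.
rewrite addr0 jh0 => /(sr2 SR) /(congr1 st).
rewrite !(srM SR) (srK SR) (sr_star0 SR) => h.
transitivity (P i ## (st (P i) ## (f x ## st (P i))) ## P i); last first.
  by rewrite h (sr0r SR) (sr0l SR).
by rewrite !mA.
Qed.

(** The triple product of [p i], [p i], [p k] vanishes, so [jh_peirce] yields a sum that
    [idem_sum_eq0] splits. *)
Lemma gridPorth i k : i != k ->
  st (P i) ## P k = 0 /\ P i ## st (P k) = 0.
Proof.
move=> ik; have := jh_peirce i (gridpe k).
rewrite (grid_orth G ik) (grid_orth G (_ : k != i)) 1?eq_sym// addr0 jh0.
move=> /(idem_sum_eq0 SR (gridll i) (gridrr i))[h1 h2]; split.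
  by rewrite -gridPPPs -!mA (mA (P i)) h1 (sr0r SR).
rewrite -[LHS](srK SR) (srM SR) (srK SR) -gridPPPs !mA -(mA _ _ (P i)).
by rewrite h2 (sr0l SR) (sr_star0 SR).
Qed.
Lemma gridlorth i k : i != k -> l i ## l k = 0.
Proof.
move=> /gridPorth[h _].
by rewrite -mA (mA _ (P k)) h (sr0l SR) (sr0r SR).
Qed.
Lemma gridrorth i k : i != k -> r i ## r k = 0.
Proof.
move=> /gridPorth[_ h].
by rewrite -mA (mA (P i)) h (sr0l SR) (sr0r SR).
Qed.

Section Offdiagonal.
Variables (i k : I) (t : A).
Hypotheses (ik : i != k) (pt : p i ** t = t) (tp : t ** p k = t).

Let Et : E t. Proof. exact: gridE tp. Qed.

Lemma offdiagl : l i ## f t + f t ## r i = f t.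
Proof. by rewrite jh_peirce// pt (grid_orthr (_ : k != i) tp) ?addr0 1?eq_sym. Qed.
Lemma offdiagr : l k ## f t + f t ## r k = f t.
Proof. by rewrite jh_peirce// tp (grid_orthl ik pt) add0r. Qed.
(** Both sides equal l_i f(t) r_k, by orthogonality of the supports. This is the part of [f t] that
    keeps left and right in place; [offdiag_rl] describes the part that exchanges them. *)
Lemma offdiag_lr : l i ## f t = f t ## r k.
Proof.
transitivity (l i ## f t ## r k).
  rewrite -[f t in LHS]offdiagr (srDr SR) mA gridlorth// (sr0l SR) add0r.
  by rewrite mA.
rewrite -[f t in RHS]offdiagl (srDl SR) -(mA _ (r i)) gridrorth// (sr0r SR).
by rewrite addr0.
Qed.
Lemma offdiag_rl : l k ## f t = f t ## r i.
Proof.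
apply: (addIr (f t ## r k)); rewrite offdiagr -offdiag_lr addrC.
by rewrite offdiagl.
Qed.
End Offdiagonal.

Local Notation S1 i := (sr_cut m st (P i) (S i)).

Lemma cutE i : S1 i = S i ## r i. Proof. by []. Qed.
Lemma cutEl i : S1 i = l (j i) ## S i.
Proof. by rewrite (offdiag_lr (grid_neq G i) (grid_l G i) (grid_r G i)). Qed.
Lemma cut_r i : S1 i ## r i = S1 i.
Proof. by rewrite -mA gridrr. Qed.
Lemma cut_split i : S i = S1 i + S i ## r (j i).
Proof.
have := offdiagr (grid_neq G i) (grid_l G i) (grid_r G i).
by rewrite (offdiag_rl (grid_neq G i) (grid_l G i) (grid_r G i)) addrC => ->.
Qed.

(** The two summands of [cut_split] have orthogonal left supports and orthogonal right supports, so
    the identity [gridSSS] restricts to the first summand. *)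
Lemma cut_tripotent i : S1 i ## st (S1 i) ## S1 i = S1 i.
Proof.
have h1 : st (S i) ## S1 i = st (S1 i) ## S1 i.
  rewrite [X in st X ## _ = _]cut_split (srD SR) (srDl SR).
  rewrite -(offdiag_rl (grid_neq G i) (grid_l G i) (grid_r G i)).
  rewrite [X in _ + st _ ## X]cutEl (srM SR (l i)) gridlst.
  by rewrite (sr_kill SR) ?addr0// gridlorth// eq_sym (grid_neq G).
have h2 : S i ## st (S1 i) = S1 i ## st (S1 i).
  rewrite [X in X ## _ = _]cut_split (srDl SR) [X in _ + _ ## st X]cutE.
  by rewrite (srM SR (S i)) gridrst (sr_kill SR) ?addr0// gridrorth// (grid_neq G).
by rewrite -h2 -mA -h1 mA cutE mA gridSSS.
Qed.

Lemma suppE i : z i = r i ## st (S i) ## (S i ## r i).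
Proof. by rewrite /sr_supp cutE (srM SR) gridrst. Qed.
Lemma cut_supp i : S1 i ## z i = S1 i.
Proof. by rewrite mA cut_tripotent. Qed.
Lemma supp_idem i : z i ## z i = z i.
Proof. by rewrite {1}/sr_supp -mA cut_supp. Qed.
Lemma supp_r i : z i ## r i = z i.
Proof. by rewrite -mA cut_r. Qed.
Lemma supp_star i : st (z i) = z i.
Proof. by rewrite (srM SR) (srK SR). Qed.
Lemma r_supp i : r i ## z i = z i.
Proof.
by rewrite -[LHS](srK SR) (srM SR) gridrst supp_star supp_r supp_star.
Qed.
Lemma supp_orth i k : i != k -> z i ## z k = 0.
Proof. by move=> ik; rewrite -supp_r -(r_supp k) (sr_kill SR)// gridrorth. Qed.

(** [S k] lives under [l (j k)] and [l k] only, so for i different from k the corner is either the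
    cut of [S k] or zero. *)
Lemma corner_tripotent i k : i != k -> 
  l i ## S k ## st (l i ## S k) ## (l i ## S k) = l i ## S k.
Proof.
move=> ik; have [<-|jki] := eqVneq (j k) i; first by rewrite -cutEl cut_tripotent.
suff -> : l i ## S k = 0 by rewrite (sr0r SR).
rewrite cut_split cutEl -(offdiag_rl (grid_neq G k) (grid_l G k) (grid_r G k)).
have kill q : i != q -> l i ## (l q ## S k) = 0.
  by move=> iq; rewrite (sr_killl SR)// gridlorth.
by rewrite (srDr SR) !kill ?addr0// eq_sym.
Qed.

(** The key vanishing. Both words of the triple product of [t], [s k], [s k] are zero, since i
    differs from k and [j k] from k. Cutting the image of this relation by [l i] on the left and
    [r k] on the right puts an idempotent on either side of [f t ## r k], and [idem_sum_eq0]
    applies. *)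
Lemma offdiag_supp i k t : i != k -> p k ** t = t -> t ** p i = t ->
  f t ## z k = 0.
Proof.
move=> ik pt tp; have Et := gridE tp; have ki : k != i by rewrite eq_sym.
have e1 : tro_prod t (s k) (s k) = 0.
  rewrite /tro_prod -[t in LHS]tp -[cstar _]grid_starl -!cmulA (cmulA (p i)).
  by rewrite (grid_orth G ik) cmul0l cmul0r.
have e2 : tro_prod (s k) (s k) t = 0.
  rewrite /tro_prod -[t in LHS]pt -grid_starr -!cmulA (cmulA (p (j k))).
  by rewrite (grid_orth G (grid_neq G k)) cmul0l !cmul0r.
have := jhJ JF Et (gridse k) (gridse k); rewrite e1 e2 addr0 jh0 => h.
pose u := l i ## S k.
have uu : u ## st u ## u = u by exact: corner_tripotent.
have nn : (u ## st u) ## (u ## st u) = u ## st u by rewrite mA uu.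
have lr := offdiag_rl ki pt tp.
have ut : st u ## (f t ## r k) = st (S k) ## f t ## r k.
  by rewrite (srM SR) gridlst -mA -lr (mA (l i) (l i)) gridll lr mA.
have : (u ## st u) ## (f t ## r k) + (f t ## r k) ## z k = 0.
  rewrite -[RHS](sr0r SR (l i)) -[X in _ = _ ## X](sr0l SR (r k)) -h.
  rewrite (srDl SR) (srDr SR) addrC; congr (_ + _).
    by rewrite -[LHS]mA r_supp suppE -(mA (r k)) mA -lr !mA.
  by rewrite -(mA u) ut /u !mA.
move=> /(idem_sum_eq0 SR nn (supp_idem k))[_].
by rewrite -mA r_supp.
Qed.

(** As [z k] lies under [r k], only [f x ## r k] matters, and the Peirce identities replace [x]
    there by [p k ** x], which is off-diagonal. *)
Lemma offgrid_supp i k x : i != k -> x ** p i = x -> f x ## z k = 0.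
Proof.
move=> ik xp; have Ex := gridE xp.
have xk := grid_orthr ik xp.
have := jh_peirce k Ex; rewrite xk addr0 => h.
have : f x ## r k = f (p k ** x) ## r k.
  rewrite -h (srDl SR) jh_peirce2//; last by rewrite -cmulA xk cmul0r.
  by rewrite add0r -(mA _ (r k)) gridrr.
move=> e1; rewrite -r_supp mA e1 -mA r_supp.
by apply: (@offdiag_supp i) => //; rewrite -?cmulA ?xp// cmulA (grid_idem G).
Qed.

Lemma ongrid_supp i x : x ** p i = x -> (f (x ** cstar (s i))) ## z i = 0.
Proof.
move=> xp; apply: (@offgrid_supp (j i)); first exact: grid_neq G i.
by rewrite -cmulA grid_starr.
Qed.

Lemma ongrid_split i x : x ** p i = x ->
  f (x ** cstar (s i)) ## st (P (j i)) ## S i +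
  S i ## st (P (j i)) ## f (x ** cstar (s i)) = f x.
Proof.
move=> xp; have Ey : E (x ** cstar (s i)).
  by apply: (@gridE (j i)); rewrite -cmulA grid_starr.
rewrite (jhJ JF)// ?gridpe ?gridse// /tro_prod (grid_star G).
rewrite -!cmulA (grid_l G) (grid_ss G) xp.
rewrite [X in x + X](_ : _ = 0) ?addr0//.
rewrite -(grid_r G i) -cmulA (cmulA (p i)) (grid_orth G) ?cmul0l ?cmul0r//.
by rewrite eq_sym (grid_neq G).
Qed.

(** In [ongrid_split], [z i] kills the word ending in [f (x ** cstar (s i))]. It leaves the other
    word unchanged, because [st (P (j i))] already cuts [S i] down to [S1 i], which [z i] fixes. *)
Lemma ongrid_suppE i x : x ** p i = x ->
  f x ## z i = f (x ** cstar (s i)) ## st (P (j i)) ## S i.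
Proof.
move=> xp; rewrite -[f x](ongrid_split xp) (srDl SR).
rewrite [X in _ + X](_ : _ = 0) ?addr0; last first.
  by rewrite -mA ongrid_supp// (sr0r SR).
have PS : st (P (j i)) ## S i = st (P (j i)) ## S1 i.
  by rewrite cutEl !mA gridPPPs.
have Sz : S i ## z i = S1 i by rewrite -[z i]r_supp mA -cutE cut_supp.
by rewrite -[LHS]mA Sz -[RHS]mA PS mA.
Qed.

Lemma supp_restr k x : E x -> f x ## z k = f (x ** p k) ## z k.
Proof.
move=> Ex; rewrite [in LHS](grid_split Ex) jh_sum => [|i]; last first.
  by apply: (@gridE i); rewrite gridK.
rewrite (sr_suml SR) (bigD1 k)//= big1 ?addr0// => i ik.
by apply: (offgrid_supp ik); rewrite gridK.
Qed.

End OneSided.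

(* phi; the antimultiplicative part psi is this sum for the opposite product *)
Definition jh_part (m : V -> V -> V) (st : V -> V) (f : A -> V) (x : A) : V :=
  \sum_i m (m (f (x ** cstar (s i))) (st (f (p (j i))))) (f (s i)).

Section PartSum.
Variables (m : V -> V -> V) (st : V -> V) (f : A -> V).
Hypothesis SR : star_ring m st.
Hypothesis JF : jordan_hom e m st f.

Local Notation E x := (x ** e = x).
Local Notation Z := (\sum_k sr_supp m st (f (p k)) (f (s k))).
Local Notation phi := (jh_part m st f).

(** The defining sum of words keeps phi inside any TRO that contains the image of f, although Z need
    not lie there; the product with Z is the form in which phi can be computed with. *)
Lemma jh_partE x : E x -> phi x = m (f x) Z.
Proof.
move=> Ex; rewrite (sr_sumr SR); apply: eq_bigr => i _.
rewrite supp_restr// (ongrid_suppE SR JF) ?gridK//.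
by rewrite -(cmulA x) grid_starl.
Qed.

Lemma jh_part_star : st Z = Z.
Proof. by rewrite (sr_star_sum SR); apply: eq_bigr => i _; rewrite supp_star. Qed.

Lemma jh_partD x y : E x -> E y -> phi (x + y) = phi x + phi y.
Proof.
move=> Ex Ey; have Exy : E (x + y) by rewrite cmulDl Ex Ey.
by rewrite !jh_partE// (jhD JF)// (srDl SR).
Qed.

Lemma jh_part_sum (J : finType) (F : J -> A) : (forall i, E (F i)) ->
  phi (\sum_i F i) = \sum_i phi (F i).
Proof.
move=> EF; have Es : E (\sum_i F i).
  by rewrite cmul_suml; apply: eq_bigr.
rewrite jh_partE// (jh_sum JF)// (sr_suml SR).
by apply: eq_bigr => i _; rewrite jh_partE.
Qed.

End PartSum.

(** * Orthogonality and multiplicativity of the two parts *)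

Section TwoSided.
Variables (m : V -> V -> V) (st : V -> V) (f : A -> V).
Hypothesis SR : star_ring m st.
Hypothesis JF : jordan_hom e m st f.

Let SR' := star_ring_flip SR.
Let JF' := jordan_hom_flip SR JF.
Let m' a b := m b a.

Local Notation "x ## y" := (m x y) (at level 40, left associativity).
Local Notation E x := (x ** e = x).
Local Notation P i := (f (p i)).
Local Notation S i := (f (s i)).
Local Notation z i := (sr_supp m st (P i) (S i)).
Local Notation z' i := (sr_supp m' st (P i) (S i)).
Local Notation Z := (\sum_k z k).
Local Notation Y := (\sum_k z' k).
Local Notation phi := (jh_part m st f).
Local Notation psi := (jh_part m' st f).
Local Notation mA := (srA SR).

Let psiE x : E x -> psi x = Y ## f x.
Proof. by move=> Ex; rewrite (jh_partE SR' JF'). Qed.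

Lemma jh_part_split x : E x -> f x = phi x + psi x.
Proof.
move=> Ex; rewrite -big_split/= [in LHS](grid_split Ex) (jh_sum JF); last first.
  by move=> i; apply: (@gridE i); rewrite gridK.
apply: eq_bigr => i _; rewrite -(ongrid_split JF (gridK i x)) /m' !mA.
by rewrite -(cmulA x) grid_starl.
Qed.

(** The product of [f x] and [z k] has two forms: [f (x ** p k)] times [z k], killed on the left by
    [z' i] for i different from k, and a word beginning with [f (x ** p k ** cstar (s k))], killed
    on the left by [z' k]. *)
Lemma jh_part_orth0 x : E x -> Y ## f x ## Z = 0.
Proof.
move=> Ex; rewrite (sr_sumr SR) big1// => k _.
rewrite -mA (supp_restr SR JF)// (sr_suml SR) (bigD1 k)//= big1 => [|i ik].
  rewrite addr0 (ongrid_suppE SR JF) ?gridK// !mA.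
  have -> : z' k ## f (x ** p k ** cstar (s k)) = 0.
    by rewrite [LHS](ongrid_supp SR' JF') ?gridK.
  by rewrite !(sr0l SR).
rewrite mA; have -> : z' i ## f (x ** p k) = 0.
  by rewrite [LHS](offgrid_supp SR' JF' _ (gridK k x))// eq_sym.
by rewrite (sr0l SR).
Qed.

Let Ystar : st Y = Y. Proof. exact: (jh_part_star f SR'). Qed.
Let Zstar : st Z = Z. Proof. exact: (jh_part_star f SR). Qed.

Lemma jh_part_orthr a b : E a -> E b -> phi a ## st (psi b) = 0.
Proof.
move=> Ea Eb; rewrite (jh_partE SR JF)// psiE// -mA.
have -> : Z ## st (Y ## f b) = st (Y ## f b ## Z) by rewrite [RHS](srM SR) Zstar.
by rewrite jh_part_orth0// (sr_star0 SR) (sr0r SR).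
Qed.

Lemma jh_part_orthl a b : E a -> E b -> st (phi a) ## psi b = 0.
Proof.
move=> Ea Eb; rewrite (jh_partE SR JF)// psiE// mA.
have -> : st (f a ## Z) ## Y = st (Y ## f a ## Z).
  by rewrite -(mA Y) [RHS](srM SR) Ystar.
by rewrite jh_part_orth0// (sr_star0 SR) (sr0l SR).
Qed.

Let orthr' a b : E a -> E b -> psi a ## st (phi b) = 0.
Proof.
by move=> Ea Eb; rewrite -[LHS](srK SR) (srM SR) (srK SR) jh_part_orthr// (sr_star0 SR).
Qed.

Let orthl' a b : E a -> E b -> st (psi a) ## phi b = 0.
Proof.
by move=> Ea Eb; rewrite -[LHS](srK SR) (srM SR) (srK SR) jh_part_orthl// (sr_star0 SR).
Qed.

Lemma jh_part_cut a b c : E a -> E b -> E c ->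
  f a ## st (f b) ## f c ## Z = phi a ## st (phi b) ## phi c.
Proof.
move=> Ea Eb Ec; rewrite -[LHS]mA -(jh_partE SR JF Ec).
rewrite (jh_part_split Ea) (jh_part_split Eb) (srD SR) !(srDl SR) !(srDr SR).
rewrite jh_part_orthr// orthr'// addr0 add0r -[X in _ + X]mA orthl'//.
by rewrite (sr0r SR) addr0.
Qed.

Lemma jh_part_jordan a b c : E a -> E b -> E c ->
  phi a ## st (phi b) ## phi c + phi c ## st (phi b) ## phi a =
  phi (tro_prod a b c) + phi (tro_prod c b a).
Proof.
move=> Ea Eb Ec; rewrite -!jh_part_cut// -(srDl SR) (jhJ JF)//.
by rewrite -(jh_partD SR JF) ?(jh_partE SR JF)// ?cmulDl !gridEM.
Qed.

(** When [b] and [c] have orthogonal right supports, the reversed word vanishes in A and, by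
    orthogonality of the supports [z], also after phi; the Jordan identity then reduces to a single
    word. *)
Let tro_step1 a b c i k : i != k -> E a -> b ** p i = b -> c ** p k = c ->
  phi (tro_prod a b c) = phi a ## st (phi b) ## phi c.
Proof.
move=> ik Ea bp cp; have Eb := gridE bp; have Ec := gridE cp.
have phip q x : x ** p q = x -> phi x = f x ## z q.
  move=> xq; rewrite (jh_partE SR JF) ?(gridE xq)// (sr_sumr SR).
  rewrite (bigD1 q)//= big1 ?addr0// => q' qq'.
  by apply: (offgrid_supp SR JF _ xq); rewrite eq_sym.
have := jh_part_jordan Ea Eb Ec.
have -> : phi c ## st (phi b) = 0.
  rewrite (phip _ _ bp) (phip _ _ cp) (srM SR) supp_star//.
  by rewrite (sr_kill SR)// (supp_orth SR JF)// eq_sym.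
have -> : tro_prod c b a = 0.
  rewrite /tro_prod -cp -bp cstarM (grid_star G).
  rewrite -!cmulA (cmulA (p k)) (grid_orth G) ?cmul0l ?cmul0r// eq_sym//.
rewrite (sr0l SR) addr0 => ->; rewrite (jh_partE SR JF (cmul0l e)) (jh0 JF).
by rewrite (sr0l SR) addr0.
Qed.

Lemma jh_part_tro a b c : E a -> E b -> E c ->
  phi (tro_prod a b c) = phi a ## st (phi b) ## phi c.
Proof.
move=> Ea Eb Ec.
have step i k b' c' : b' ** p i = b' -> c' ** p k = c' ->
    phi (tro_prod a b' c') = phi a ## st (phi b') ## phi c'.
  move=> bp cp; have [ik|] := eqVneq i k; last by move=> /tro_step1; apply.
  move: cp; rewrite -{k}ik => cp.
  have jpi : (b' ** cstar (s i)) ** p (j i) = b' ** cstar (s i).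
    by rewrite -cmulA grid_starr.
  have nji := grid_neq G i; have nij : i != j i by rewrite eq_sym.
  (* When i = k, inserting [s i] makes a detour through [p (j i)]. Every product involved then has
     its last two factors supported on different grid projections, where [tro_step1] applies. *)
  have e1 : tro_prod a b' c' = tro_prod (tro_prod a (s i) (p (j i)))
                                  (b' ** cstar (s i)) c'.
    rewrite /tro_prod cstarM cstarK.
    have bs : p i ** cstar b' = cstar b' by rewrite -{1}(grid_star G) -cstarM bp.
    by rewrite -[in LHS]bs -(grid_ss G i) -[in LHS](grid_starr i) !cmulA.
  have e2 : b' = tro_prod (b' ** cstar (s i)) (p (j i)) (s i).
    by rewrite /tro_prod (grid_star G) -!cmulA (grid_l G) (grid_ss G) bp.
  rewrite e1 (tro_step1 nji _ jpi cp) ?(tro_step1 nij) ?(grid_r G) ?(grid_idem G)//; last first.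
    by rewrite gridEM// gridpe.
  rewrite [in RHS]e2 (tro_step1 nji) ?(grid_r G) ?(grid_idem G)//; last first.
    exact: gridE jpi.
  by rewrite !(srM SR) !(srK SR) !mA.
have EM x k : E (x ** p k) by rewrite -cmulA gridpe.
rewrite {1}(grid_split Ec) /tro_prod cmul_sumr (jh_part_sum SR JF); last first.
  by move=> k; rewrite gridEM.
rewrite [in RHS](grid_split Ec) (jh_part_sum SR JF) ?(sr_sumr SR)//.
apply: eq_bigr => k _.
have -> : a ** cstar b ** (c ** p k) = \sum_i tro_prod a (b ** p i) (c ** p k).
  rewrite /tro_prod -[RHS]cmul_suml -[X in _ = X ** _]cmul_sumr.
  rewrite [in LHS](grid_split Eb).
  by congr (_ ** _ ** _); apply: big_morph => [x y|]; rewrite ?cstarD ?cstar0.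
rewrite (jh_part_sum SR JF) => [|i]; last by rewrite gridEM.
rewrite [b in RHS](grid_split Eb) (jh_part_sum SR JF)// (sr_star_sum SR).
rewrite (sr_sumr SR) (sr_suml SR); apply: eq_bigr => i _.
exact/step/gridK/gridK.
Qed.

End TwoSided.
End Decomposition.

(** * Hilbert spaces *)

(** Conditions on pairs pass to unions of chains, since any two elements of the union already lie in
    one member. The condition [r x x] is the pair formed by the new element with itself. *)
Lemma maximal_clique T (r : T -> T -> Prop) : (forall x y, r x y -> r y x) ->
  exists M : set T, (forall x y, M x -> M y -> r x y) /\
    forall x, r x x -> (forall y, M y -> r x y) -> M x.
Proof.
move=> rC; pose P (X : set T) := forall x y, X x -> X y -> r x y.
have [M [PM Mmax]] : exists A, P A /\ forall B, A `<` B -> ~ P B.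
  apply: Zorn_bigcup => F FP Ftot x y [X FX Xx] [Y FY Yy].
  have [XY|YX] := Ftot _ _ FX FY.
    by apply: (FP _ FY) => //; exact: XY.
  by apply: (FP _ FX) => //; exact: YX.
exists M; split=> // x rxx rxM; apply: contrapT => Mx.
apply: (Mmax (M `|` [set x])).
  by split=> [y My|MxM]; [left|apply: Mx; apply: MxM; right].
by move=> y z [My|->] [Mz|->] => //; [exact: PM|apply: rC; exact: rxM|exact: rxM].
Qed.

(** * Real inner product and projection onto a real subspace *)

Section RealInner.
Context {R : realType} {H : hilbertType R}.
Implicit Types (x y z : H) (t : R).

Definition rdot x y : R := complex.Re (hdot x y).

Lemma rdotDl x y z : rdot (x + y) z = rdot x z + rdot y z.
Proof. by rewrite /rdot hdotDl raddfD. Qed.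
Lemma rdotDr x y z : rdot z (x + y) = rdot z x + rdot z y.
Proof. by rewrite /rdot hdotDr raddfD. Qed.
Lemma rdotBl x y z : rdot (x - y) z = rdot x z - rdot y z.
Proof. by rewrite /rdot hdotBl raddfB. Qed.
Lemma rdotBr x y z : rdot z (x - y) = rdot z x - rdot z y.
Proof. by rewrite /rdot hdotBr raddfB. Qed.
Lemma rdotC x y : rdot x y = rdot y x.
Proof. by rewrite /rdot hdotC; case: (hdot y x). Qed.
Lemma rdotZl t x y : rdot (t%:C%C *: x) y = t * rdot x y.
Proof. by rewrite /rdot hdotZl; case: (hdot x y) => a b /=; ring. Qed.
Lemma rdotZr t x y : rdot x (t%:C%C *: y) = t * rdot x y.
Proof. by rewrite rdotC rdotZl rdotC. Qed.

Lemma rdot_norm x : rdot x x = rnorm x ^+ 2.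
Proof. by rewrite /rdot hdot_norm rnormE -rmorphXn. Qed.
Lemma rnorm_ge0 x : 0 <= rnorm x.
Proof. by have := normr_ge0 x; rewrite rnormE lecR. Qed.

Lemma rnorm_lt x t : (`|x| < t%:C%C) = (rnorm x < t).
Proof. by rewrite rnormE ltcR. Qed.

Lemma hdot_rdot x y : hdot x y = (rdot x y +i* rdot x ('i *: y))%C.
Proof.
rewrite /rdot hdotZr; case: (hdot x y) => a b /=.
by apply/eqP; rewrite eq_complex /= eqxx; apply/eqP => /=; ring.
Qed.

End RealInner.

Section Projection.
Context {R : realType} {H : hilbertType R}.
Implicit Types (x y z : H) (t : R).

Lemma rdot_CS x y : `|rdot x y| <= rnorm x * rnorm y.
Proof.
rewrite -lecR rmorphM/= -!rnormE; apply: le_trans (hdot_CS x y).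
exact: normc_ge_Re.
Qed.

(** [S] is not assumed closed, so [z] is only approximated by [S]; in both uses maximality then
    shows that the limit belongs to the set. Real scalars are what a real form of H offers. *)
Lemma real_projection (S : set H) (h : H) : S 0 ->
    (forall x y, S x -> S y -> S (x + y)) ->
    (forall t x, S x -> S (t%:C%C *: x)) ->
  exists z, (forall d : R, 0 < d -> exists2 x, S x & rnorm (z - x) < d) /\
            forall x, S x -> rdot (h - z) x = 0.
Proof.
move=> S0 SD SZ; pose q x := rdot (h - x) (h - x).
have qn x : q x = rnorm (h - x) ^+ 2 by exact: rdot_norm.
have q0 x : 0 <= q x by rewrite qn exprn_ge0// rnorm_ge0.
have qinf : has_inf (q @` S).
  by split; [exists (q 0), 0|exists 0 => _ [x _ <-]].
pose m := inf (q @` S).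
have qge x : S x -> m <= q x by move=> Sx; apply: ge_inf; [case: qinf|exists x].
have par x y : S x -> S y -> rdot (x - y) (x - y) <= 2 * q x + 2 * q y - 4 * m.
  move=> Sx Sy; have := qge _ (SZ 2^-1 _ (SD _ _ Sx Sy)).
  rewrite /q !(rdotBl, rdotBr, rdotDl, rdotDr, rdotZl, rdotZr).
  rewrite (rdotC x h) (rdotC y h) (rdotC y x); set a := m; lra.
pose F := filter_from [set e : R | 0 < e]
  (fun e => [set x | S x /\ q x < m + e]).
have FF : ProperFilter F.
  apply: filter_from_proper; first apply: filter_from_filter.
  - by exists 1 => /=.
  - move=> a b /= a0 b0; exists (Num.min a b) => /=; first by rewrite lt_min a0.
    move=> x /= [Sx]; rewrite -ltrBlDl lt_min => /andP[].
    by rewrite !ltrBlDl; split.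
  - move=> e /= e0; have [_ [x Sx <-]] := inf_adherent e0 qinf.
    by exists x.
have /cauchy_cvg/cvg_ex[/= z Fz] : cauchy F.
  apply/cauchy_ballP => e e0 /=.
  have er : (complex.Re e)%:C%C = e by rewrite RRe_real// gtr0_real.
  have er0 : 0 < complex.Re e by rewrite -ltcR er.
  have e'0 : 0 < (complex.Re e) ^+ 2 / 4 by rewrite divr_gt0// exprn_gt0.
  near=> x y; rewrite -ball_normE /= -er rnorm_lt.
  have [Sx qx] : S x /\ q x < m + (complex.Re e) ^+ 2 / 4.
    by near: x; exists ((complex.Re e) ^+ 2 / 4).
  have [Sy qy] : S y /\ q y < m + (complex.Re e) ^+ 2 / 4.
    by near: y; exists ((complex.Re e) ^+ 2 / 4).
  rewrite -(@ltr_pXn2r _ 2%N) ?nnegrE ?rnorm_ge0// -?rdot_norm; last exact: ltW.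
  by have := par _ _ Sx Sy; lra.
have near_z (d : R) : 0 < d -> F [set x | rnorm (z - x) < d].
  move=> d0; have d0' : 0 < d%:C%C by rewrite ltcR.
  have := Fz _ (nbhsx_ballx z _ d0'); apply: filterS => x.
  by rewrite -ball_normE /= rnorm_lt.
have FS : F S by exists 1 => //= x [].
exists z; split=> [d d0|].
  have /filter_ex[x [Sx xz]] : F (S `&` [set x | rnorm (z - x) < d]).
    exact: filterI FS (near_z _ d0).
  by exists x.
(* The first variation of [q] at [z], obtained up to [d] from points [y] of [S] near [z]. The
   constant [c] bounds the error of replacing [z] by [y] by [d / 2], and near-minimality of [q y]
   costs the other half. *)
have key t x : S x -> 2 * t * rdot (h - z) x <= t ^+ 2 * rdot x x.
  move=> Sx; apply/ler_addgt0Pr => d d0.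
  pose c := 1 + 2 * `|t| * rnorm x.
  have c0 : 0 < c by rewrite /c ltr_wpDr// mulr_ge0 ?rnorm_ge0// mulr_ge0.
  have dc0 : 0 < d / (2 * c) by rewrite divr_gt0// mulr_gt0.
  have Fd : F [set y | S y /\ q y < m + d / 2].
    by exists (d / 2) => //=; rewrite divr_gt0.
  have /filter_ex[y [[Sy qy] zy]] : F ([set y | S y /\ q y < m + d / 2] `&`
      [set y | rnorm (z - y) < d / (2 * c)]).
    exact: filterI Fd (near_z _ dc0).
  have := qge _ (SD _ _ Sy (SZ t _ Sx)).
  have -> : q (y + t%:C%C *: x) =
      q y - 2 * t * rdot (h - y) x + t ^+ 2 * rdot x x.
    rewrite /q !(rdotBl, rdotBr, rdotDl, rdotDr, rdotZl, rdotZr).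
    by rewrite (rdotC x h) (rdotC y h) (rdotC y x); ring.
  have -> : rdot (h - y) x = rdot (h - z) x + rdot (z - y) x.
    by rewrite -rdotDl addrA subrK.
  have h1 : - (2 * t * rdot (z - y) x) <= d / 2.
    apply: (@le_trans _ _ (2 * `|t| * (rnorm (z - y) * rnorm x))).
      rewrite (le_trans (ler_norm _))// normrN !normrM ger0_norm//.
      by rewrite ler_wpM2l ?mulr_ge0// rdot_CS.
    rewrite mulrCA (le_trans (ler_wpM2r _ (ltW zy)))// ?mulr_ge0 ?rnorm_ge0//.
    have -> : d / 2 = d / (2 * c) * c by field; rewrite gt_eqF.
    by rewrite ler_wpM2l ?(ltW dc0)// /c lerDr.
  by move: h1 qy; set a := m; lra.
move=> x Sx; apply/eqP; rewrite eq_le; set a := rdot (h - z) x.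
have {}key t : 2 * t * a <= t ^+ 2 * rdot x x by exact: key.
have n0 : 0 <= rdot x x by rewrite rdot_norm exprn_ge0 ?rnorm_ge0.
suff : a ^+ 2 <= 0.
  move=> a2; have /eqP -> : a == 0 by rewrite -sqrf_eq0 eq_le a2 sqr_ge0.
  by rewrite lexx.
(* The best choice of [t] would be [a / rdot x x]; adding 1 to the denominator also covers x = 0 and
   still leaves a positive factor [b * (1 + b)]. *)
pose b := (1 + rdot x x)^-1.
have bx : b * (1 + rdot x x) = 1 by rewrite mulVf// gt_eqF// ltr_wpDr.
have b0 : 0 < b by rewrite invr_gt0 ltr_wpDr.
have := key (a * b); rewrite -subr_ge0 => hk.
have : 0 <= - a ^+ 2 * (2 * b - b * (b * rdot x x)).
  by move: hk; congr (0 <= _); ring.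
have -> : b * rdot x x = 1 - b by rewrite -bx; ring.
have -> : 2 * b - b * (1 - b) = b * (1 + b) by ring.
by rewrite pmulr_lge0 ?oppr_ge0// mulr_gt0// addr_gt0.
Unshelve. all: by end_near. Qed.

End Projection.

(** * A conjugation commuting with a projection *)

Section ConjugationExists.
Context {R : realType} {H : hilbertType R}.
Implicit Types (x y z : H) (t : R).
Local Notation C := R[i].
Local Notation i := ('i : C).

Lemma bopN (f : bop H) x : f (- x) = - f x.
Proof. by rewrite -scaleN1r bopZ scaleN1r. Qed.
Lemma scale_ii x : i *: (i *: x) = - x.
Proof. by rewrite scalerA -expr2 sqrCi scaleN1r. Qed.
Lemma rdot_ii x y : rdot (i *: x) (i *: y) = rdot x y.
Proof. by rewrite /rdot hdotZl hdotZr conjCi mulrA mulrN -expr2 sqrCi opprK mul1r. Qed.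
Lemma rdotNr x y : rdot x (- y) = - rdot x y.
Proof. by rewrite -[- y]add0r rdotBr (_ : rdot x 0 = 0) ?sub0r// -(subrr 0) rdotBr subrr. Qed.
Lemma rdot_ir x y : rdot x (i *: y) = - rdot (i *: x) y.
Proof. by rewrite -rdot_ii scale_ii rdotNr. Qed.
Lemma rdot_ixx x : rdot x (i *: x) = 0.
Proof. by have := rdot_ir x x; rewrite (rdotC (i *: x)); lra. Qed.
Lemma rdot0r x : rdot x 0 = 0.
Proof. by rewrite -(subrr x) rdotBr subrr. Qed.
Lemma rdot_eq0 x : rdot x x = 0 -> x = 0.
Proof.
rewrite rdot_norm => /eqP; rewrite sqrf_eq0 => /eqP x0.
by apply/eqP; rewrite -normr_eq0 rnormE x0.
Qed.

Lemma rdot_approx0 x y : (forall d : R, 0 < d ->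
  exists2 z, rdot z y = 0 & rnorm (x - z) < d) -> rdot x y = 0.
Proof.
move=> h; apply/eqP; rewrite -normr_le0; apply/ler_addgt0Pr => d d0.
have y1 : 0 < 1 + rnorm y by rewrite ltr_wpDr ?rnorm_ge0.
have [z zy xz] := h _ (divr_gt0 d0 y1).
rewrite add0r -[rdot x y]subr0 -zy -rdotBl (le_trans (rdot_CS _ _))//.
rewrite (le_trans (ler_wpM2r (rnorm_ge0 y) (ltW xz)))//.
by rewrite -mulrA ger_pMr// mulrC ler_pdivrMr// mul1r lerDr.
Qed.

Lemma projection_dot (e : bop H) x y : cstar e = e -> hdot (e x) y = hdot x (e y).
Proof. by move=> es; rewrite adjointE -[adjoint e]/(cstar e) es. Qed.

(* S is a maximal set of vectors on which both <x, y> and <e x, y> are real: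
   if h - z is orthogonal to S for the real part of the inner product, then
   i (h - z) satisfies the same conditions, hence lies in S. *)
Lemma real_form_exists (e : bop H) : is_projection e ->
  exists S : set H, [/\ S 0, forall t x y, S x -> S y -> S (t%:C%C *: x + y),
    forall x, S x -> S (e x),
    forall x y, S x -> S y -> rdot x (i *: y) = 0 &
    forall x, exists u v, [/\ S u, S v & x = u + i *: v]].
Proof.
move=> [ee es]; have ed x y : rdot (e x) y = rdot x (e y).
  by rewrite /rdot projection_dot.
have eeE x : e (e x) = e x by rewrite -[in RHS]ee.
pose r x y := rdot x (i *: y) = 0 /\ rdot x (i *: e y) = 0.
have rC x y : r x y -> r y x.
  move=> [h1 h2]; split; first by rewrite rdot_ir rdotC h1 oppr0.
  by rewrite rdot_ir -ed bopZ rdotC h2 oppr0.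
have [S [Sr Smax]] := maximal_clique rC.
have rD x y w : r x w -> r y w -> r (x + y) w.
  by move=> [a b] [c d]; split; rewrite rdotDl ?a ?b ?c ?d addr0.
have rZ t x w : r x w -> r (t%:C%C *: x) w.
  by move=> [a b]; split; rewrite rdotZl ?a ?b mulr0.
have rE x w : r x w -> r (e x) w.
  by move=> [a b]; split; rewrite ed bopZ ?eeE.
have S0 : S 0.
  have r0 y : r 0 y by split; rewrite rdotC rdot0r.
  by apply: (Smax) => [|y _]; exact: r0.
have SD x y : S x -> S y -> S (x + y).
  move=> Sx Sy; apply: (Smax) => [|z Sz]; last by apply: (rD); exact: Sr.
  by apply: (rD); apply: (rC); apply: (rD); exact: Sr.
have SZ t x : S x -> S (t%:C%C *: x).
  move=> Sx; apply: (Smax) => [|z Sz]; last by apply: (rZ); exact: Sr.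
  by apply: (rZ); apply: (rC); apply: (rZ); exact: Sr.
have SE x : S x -> S (e x).
  move=> Sx; apply: (Smax) => [|z Sz]; last by apply: (rE); exact: Sr.
  by apply: (rE); apply: (rC); apply: (rE); exact: Sr.
have Sdot x y : S x -> S y -> rdot x (i *: y) = 0.
  by move=> Sx Sy; have [] := Sr _ _ Sx Sy.
exists S; split=> [||//|//|h]; first exact: S0.
  by move=> t x y Sx Sy; exact: SD (SZ _ _ Sx) Sy.
have [z [zS zorth]] := real_projection h S0 SD SZ.
have rzS y : S y -> r z y.
  move=> Sy; split; apply: rdot_approx0 => d /zS[x Sx xz]; exists x => //.
    exact: Sdot.
  exact/Sdot/SE.
have Sz : S z.
  apply: (Smax) => //; apply: (rC); split; apply: rdot_approx0 => d /zS[x Sx xz];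
    by exists x => //; have [] := rC _ _ (rzS _ Sx).
pose w := i *: (h - z); have Sw : S w.
  apply: (Smax) => [|y Sy].
    split; first exact: rdot_ixx.
    have : rdot w (i *: e w) = - rdot w (i *: e w).
      by rewrite {1}rdot_ir -ed bopZ rdotC.
    by set a := rdot w _; lra.
  by split; rewrite rdot_ii zorth//; exact: SE.
exists z, (- w); split=> //.
  by have := SZ (-1) _ Sw; rewrite rmorphN rmorph1 scaleN1r.
by rewrite scalerN scale_ii opprK addrC subrK.
Qed.

(** J is u + i v |-> u - i v for u, v in the real form S. Components are unique because S and i S
    are orthogonal for the real inner product, and J commutes with e because e maps S into
    itself. *)
Lemma conjugation_exists (e : bop H) : is_projection e ->
  exists J : conjugation H, forall x, J (e x) = e (J x).
Proof.
move=> pe; have [S [S0 SDZ SE Sdot Sdec]] := real_form_exists pe.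
have SD x y : S x -> S y -> S (x + y).
  by move=> Sx Sy; have := SDZ 1 _ _ Sx Sy; rewrite rmorph1 scale1r.
have SZ t x : S x -> S (t%:C%C *: x).
  by move=> Sx; have := SDZ t _ _ Sx S0; rewrite addr0.
have /choice[c cP] : forall x, exists uv : H * H,
    [/\ S uv.1, S uv.2 & x = uv.1 + i *: uv.2].
  by move=> x; have [u [v [Su Sv ->]]] := Sdec x; exists (u, v).
pose J x := (c x).1 - i *: (c x).2.
have SN x : S x -> S (- x).
  by move=> Sx; have := SZ (-1) _ Sx; rewrite rmorphN rmorph1 scaleN1r.
have uniq0 u v : S u -> S v -> u + i *: v = 0 -> u = 0 /\ v = 0.
  move=> Su Sv uv; have u0 : u = 0.
    apply: rdot_eq0; have := Sdot _ _ Su Sv.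
    by rewrite -[i *: v](addKr u) uv addr0 rdotNr => /eqP; rewrite oppr_eq0 => /eqP.
  split=> //; apply: oppr_inj; rewrite oppr0 -scale_ii.
  by move: uv; rewrite u0 add0r => ->; rewrite scaler0.
have JE u v : S u -> S v -> J (u + i *: v) = u - i *: v.
  move=> Su Sv; rewrite /J; have := cP (u + i *: v).
  case: (c _) => u' v' /= [Su' Sv' /eqP]; rewrite -subr_eq0 opprD addrACA -scalerBr.
  move=> /eqP /uniq0[||/subr0_eq <- /subr0_eq <-//]; exact/SD/SN.
have JD x y : J (x + y) = J x + J y.
  have [u [v [Su Sv ->]]] := Sdec x; have [u' [v' [Su' Sv' ->]]] := Sdec y.
  rewrite addrACA -scalerDr !JE//; try exact: SD.
  by rewrite scalerDr opprD addrACA.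
have JZ t x : J (t%:C%C *: x) = t%:C%C *: J x.
  have [u [v [Su Sv ->]]] := Sdec x.
  rewrite scalerDr scalerA mulrC -scalerA !JE//; try exact: SZ.
  by rewrite scalerBr !scalerA mulrC.
have Ji x : J (i *: x) = - (i *: J x).
  have [u [v [Su Sv ->]]] := Sdec x.
  rewrite scalerDr scale_ii addrC !JE//; last exact: SN.
  by rewrite scalerBr scale_ii opprK opprD addrC.
have Jlin : forall (a : C) x y, J (a *: x + y) = a^* *: J x + J y.
  move=> a x y; rewrite JD; congr (_ + _); case: a => u v.
  have -> : (u +i* v)%C = u%:C%C + i * v%:C%C by rewrite [LHS]complexE.
  rewrite scalerDl -scalerA JD JZ Ji JZ rmorphD rmorphM/= conjCi.
  rewrite !conj_Creal ?complex_real//.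
  by rewrite scalerDl mulNr scaleNr -scalerA.
have Jiso x : `|J x| = `|x|.
  have [u [v [Su Sv ->]]] := Sdec x; rewrite JE// !rnormE; congr (_%:C%C).
  apply/eqP; rewrite -(@eqrXn2 _ 2%N) ?rnorm_ge0//; apply/eqP.
  rewrite -!rdot_norm !(rdotBl, rdotBr, rdotDl, rdotDr) (rdotC _ u).
  by rewrite (Sdot _ _ Su Sv); ring.
have JK : involutive J.
  move=> x; have [u [v [Su Sv ->]]] := Sdec x.
  by rewrite JE// -scalerN JE ?scalerN ?opprK//; exact: SN.
exists (Conjugation Jlin Jiso JK) => x /=.
have [u [v [Su Sv ->]]] := Sdec x.
rewrite bopD bopZ !JE//; try exact: SE.
by rewrite bopD bopN bopZ.
Qed.
End ConjugationExists.

(** * Rank-one operators *)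

Section RankOne.
Context {R : realType} {H : hilbertType R}.
Implicit Types (x y z h k : H) (t : R).
Local Notation C := R[i].

Lemma hdot0l x : hdot 0 x = 0.
Proof. by rewrite -(subrr x) hdotBl subrr. Qed.
Lemma hdot0r x : hdot x 0 = 0.
Proof. by rewrite -(subrr x) hdotBr subrr. Qed.
Lemma hdot_eq0 x : hdot x x = 0 -> x = 0.
Proof.
by rewrite hdot_norm => /eqP; rewrite sqrf_eq0 normr_eq0 => /eqP.
Qed.
Lemma hdot_eq0C x y : hdot x y = 0 -> hdot y x = 0.
Proof. by move=> xy; rewrite hdotC xy rmorph0. Qed.

(** Two coordinates are treated at once so that relations on a graph pass to limits; a zero [a] or
    [b] isolates one coordinate. *)
Lemma hdot_approx u w a b : (forall d : R, 0 < d -> exists x y,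
    [/\ rnorm (u - x) < d, rnorm (w - y) < d & hdot x a + hdot y b = 0]) ->
  hdot u a + hdot w b = 0.
Proof.
move=> h; apply/eqP; rewrite -normr_le0.
pose K := 1 + rnorm a + rnorm b.
have K0 : 0 < K by rewrite /K -addrA ltr_wpDr// addr_ge0 ?rnorm_ge0.
apply/ler_addgt0Pr => d d0; rewrite add0r.
have dE : (complex.Re d)%:C%C = d by rewrite RRe_real// gtr0_real.
have d0' : 0 < complex.Re d by rewrite -ltcR dE.
have [x [y [ux wy xy]]] := h _ (divr_gt0 d0' K0).
have -> : hdot u a + hdot w b = hdot (u - x) a + hdot (w - y) b.
  by rewrite !hdotBl addrACA -opprD xy subr0.
rewrite (le_trans (ler_normD _ _))//.
rewrite (le_trans (lerD (hdot_CS _ _) (hdot_CS _ _)))//.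
rewrite !rnormE -!rmorphM -rmorphD -dE lecR.
have -> : complex.Re d = complex.Re d / K * (1 + rnorm a + rnorm b).
  by rewrite -/K; field; rewrite gt_eqF.
have dK : 0 <= complex.Re d / K by rewrite ltW// divr_gt0.
rewrite !mulrDr -addrA ler_wpDl//; first by rewrite mulr_ge0.
by rewrite lerD// ler_wpM2r ?rnorm_ge0// ltW.
Qed.

Definition rank1_fun (xi eta : H) x : H := hdot x xi *: eta.

Lemma rank1_bounded xi eta : rank1_fun xi eta \in @bounded_linear R H.
Proof.
apply/asboolP; split=> [a x y|]; first by rewrite /rank1_fun hdotDl hdotZl scalerDl scalerA.
exists (`|xi| * `|eta|) => x; rewrite normrZ mulrAC ler_wpM2r//.
by rewrite mulrC hdot_CS.
Qed.

Definition rank1 xi eta : bop H := Bop (rank1_bounded xi eta).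

Lemma cstar_dot (f : bop H) x y : hdot (f x) y = hdot x (cstar f y).
Proof. exact: adjointE. Qed.

Lemma rank1_star xi eta : cstar (rank1 xi eta) = rank1 eta xi.
Proof.
apply: bopP => x; apply: hdot_inj => y; rewrite -cstar_dot /=.
by rewrite /rank1_fun hdotZl hdotZr mulrC -hdotC.
Qed.

Lemma cmulE (f g : bop H) x : cmul f g x = f (g x).
Proof. by []. Qed.

(** Rank at most one is expressed by the absence of two nonzero orthogonal vectors in the range of
    [r]. The operator [s] sends a unit vector of that range to a unit vector of the range of [p]. *)
Lemma rank1_link (r p : bop H) : is_projection r -> is_projection p ->
  (forall g h, hdot (r g) (r h) = 0 -> r g = 0 \/ r h = 0) ->
  (p = 0 -> r = 0) ->
  exists s : bop H, [/\ cmul p s = s, cmul s r = s & cmul (cstar s) s = r].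
Proof.
move=> [rr rs] [pp ps] rk1 pr.
have [r0|rn0] := pselect (r = 0).
  by exists 0; rewrite r0 !cmul0r.
have neq0 (f : bop H) : f <> 0 -> exists x, f x <> 0.
  move=> f0; apply: contrapT => h; apply/f0/bopP => y; apply: contrapT => fy.
  by apply: h; exists y.
have [k /eqP pk0] : exists k, p k <> 0 by apply: neq0 => /pr.
have [g /eqP rg0] := neq0 _ rn0.
have rrE x : r (r x) = r x by rewrite -[in RHS]rr.
have ppE x : p (p x) = p x by rewrite -[in RHS]pp.
pose xi := r g; pose eta := p k.
have nxi : `|xi| != 0 by rewrite normr_eq0.
have neta : `|eta| != 0 by rewrite normr_eq0.
pose c : C := (`|xi| * `|eta|)^-1.
have cJ : c^* = c by rewrite conj_Creal// ger0_real// invr_ge0 mulr_ge0.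
exists (c *: rank1 xi eta); split; apply: bopP => h.
- by rewrite cmulZr !bopZE cmulE /= /rank1_fun bopZ ppE.
- by rewrite cmulZl !bopZE cmulE /= /rank1_fun cstar_dot rs rrE.
rewrite cstarZ cJ cmulZl cmulZr !bopZE cmulE rank1_star /= /rank1_fun hdotZl hdot_norm.
rewrite !scalerA; set t := (X in X *: xi).
have tE : t * `|xi| ^+ 2 = hdot h xi.
  by rewrite /t /c; field; apply/andP.
(* [t] is the Gram-Schmidt coefficient of [r h] along [xi]; the rank condition turns this
   orthogonality into [r h = t *: xi]. *)
have : hdot (r (h - t *: g)) (r g) = 0.
  rewrite cstar_dot rs rrE hdotBl hdotZl -/xi -tE -hdot_norm.
  by rewrite [X in _ - _ * X](_ : _ = hdot xi xi) ?subrr// /xi cstar_dot rs rrE.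
move=> /rk1[|/eqP]; last by rewrite (negbTE rg0).
by rewrite bopD bopN bopZ => /subr0_eq.
Qed.
End RankOne.

(** * Halving a projection *)

Section HalvingGraph.
Context {R : realType} {H : hilbertType R}.
Implicit Types (x y z h k : H) (t : R).
Local Notation C := R[i].

Lemma hdot_eq_norm x y : hdot x x = hdot y y -> `|x| = `|y|.
Proof.
rewrite !hdot_norm => /eqP.
by rewrite eqrXn2// => /eqP.
Qed.

(* G is the graph of a maximal partial isometry of eH with range orthogonal to
   its domain; both conditions bear on pairs of elements of the graph, and
   maximality makes G linear and closed. *)
Lemma halving_graph (e : bop H) : is_projection e ->
  exists G : set (H * H),
  [/\ forall (a : C) u v, G u -> G v -> G (a *: u + v),
      forall u, G u -> e u.1 = u.1 /\ e u.2 = u.2,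
      forall u v, G u -> G v -> hdot u.1 v.1 = hdot u.2 v.2 /\ hdot u.1 v.2 = 0,
      forall x y, e x = x -> e y = y -> hdot x x = hdot y y -> hdot x y = 0 ->
        (forall u, G u -> [/\ hdot x u.1 = 0, hdot x u.2 = 0,
                              hdot y u.1 = 0 & hdot y u.2 = 0]) -> G (x, y) &
      forall h, exists2 u, G u & forall v, G v -> hdot (h - u.1) v.1 = 0].
Proof.
move=> [ee es].
pose Q (u v : H * H) := [/\ hdot u.1 v.1 = hdot u.2 v.2, hdot u.1 v.2 = 0 & hdot u.2 v.1 = 0].
pose K (u : H * H) := e u.1 = u.1 /\ e u.2 = u.2.
pose r u v := [/\ K u, K v & Q u v].
have QC u v : Q u v -> Q v u.
  move=> [q1 q2 q3]; split; [|exact: hdot_eq0C|exact: hdot_eq0C].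
  by rewrite hdotC q1 -hdotC.
have rC u v : r u v -> r v u by move=> [Ku Kv /QC].
have [G [Gr Gmax]] := maximal_clique rC.
have GK u : G u -> K u by move=> Gu; have [] := Gr _ _ Gu Gu.
have GQ u v : G u -> G v -> Q u v by move=> Gu Gv; have [] := Gr _ _ Gu Gv.
have {}Gmax u : K u -> Q u u -> (forall v, G v -> Q u v) -> G u.
  by move=> Ku Quu Qu; apply: Gmax => // v Gv; split=> //; [exact: GK|exact: Qu].
have QL (a : C) u v w : Q u w -> Q v w -> Q (a *: u + v) w.
  move=> [q1 q2 q3] [p1 p2 p3]; split; rewrite /= !hdotDl !hdotZl.
  - by rewrite q1 p1.
  - by rewrite q2 p2 mulr0 addr0.
  - by rewrite q3 p3 mulr0 addr0.
have GL (a : C) u v : G u -> G v -> G (a *: u + v).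
  move=> Gu Gv; have QG w : G w -> Q (a *: u + v) w.
    by move=> Gw; apply: (QL); exact: GQ.
  apply: (Gmax) => //; last by apply: (QL); apply: (QC); exact: QG.
  have [eu1 eu2] := GK _ Gu; have [ev1 ev2] := GK _ Gv.
  by split; rewrite /= bopD bopZ ?eu1 ?eu2 ?ev1 ?ev2.
have Q0 u : Q 0 u by split; rewrite /= !hdot0l.
have G0 : G 0.
  by apply: (Gmax) => //; split; rewrite /= bop0.
exists G; split=> //.
- by move=> u v Gu Gv; have [] := GQ _ _ Gu Gv.
- move=> x y ex ey xx xy Gxy; apply: (Gmax) => //.
    by split=> //=; exact: hdot_eq0C.
  by move=> v /Gxy[p1 p2 p3 p4]; split=> //=; rewrite p1 p4.
move=> h; pose D x := exists y, G (x, y).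
have D0 : D 0 by exists 0.
have DL (a : C) x y : D x -> D y -> D (a *: x + y).
  by move=> [x' Gx] [y' Gy]; exists (a *: x' + y'); exact: (GL a _ _ Gx Gy).
have DD x y : D x -> D y -> D (x + y).
  by move=> Dx Dy; have := DL 1 _ _ Dx Dy; rewrite scale1r.
have DZ (a : C) x : D x -> D (a *: x).
  by move=> Dx; have := DL a _ _ Dx D0; rewrite addr0.
have [z [zD zorth]] := real_projection h D0 DD (fun t => DZ _).
have zorthC x : D x -> hdot (h - z) x = 0.
  by move=> Dx; rewrite hdot_rdot !zorth//; exact: DZ.
have Gnorm u v : G u -> G v -> rnorm (u.1 - v.1) = rnorm (u.2 - v.2).
  move=> Gu Gv; have := GL (-1) _ _ Gv Gu.
  rewrite scaleN1r addrC => Guv; have [/= q _ _] := GQ _ _ Guv Guv.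
  by rewrite /rnorm (hdot_eq_norm q).
(* The second coordinates of points of [G] whose first coordinate tends to [z]. They are Cauchy
   because [G] is isometric, and their limit is the candidate value at [z]. *)
pose F := filter_from [set d : R | 0 < d]
  (fun d => [set y | exists x, G (x, y) /\ rnorm (z - x) < d]).
have FF : ProperFilter F.
  apply: filter_from_proper; first apply: filter_from_filter.
  - by exists 1 => /=.
  - move=> a b /= a0 b0; exists (Num.min a b) => /=; first by rewrite lt_min a0.
    by move=> y /= [x [Gxy]]; rewrite lt_min => /andP[xa xb]; split; exists x.
  - by move=> d /= /zD[x [y Gxy] zx]; exists y, x.
have /cauchy_cvg/cvg_ex[/= w Fw] : cauchy F.
  apply/cauchy_ballP => d d0 /=.
  have dE : (complex.Re d)%:C%C = d by rewrite RRe_real// gtr0_real.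
  have d0' : 0 < complex.Re d / 2 by rewrite divr_gt0// -ltcR dE.
  near=> y y'; rewrite -ball_normE /=.
  have [x [Gxy zx]] : exists x, G (x, y) /\ rnorm (z - x) < complex.Re d / 2.
    by near: y; exists (complex.Re d / 2).
  have [x' [Gxy' zx']] : exists x, G (x, y') /\ rnorm (z - x) < complex.Re d / 2.
    by near: y'; exists (complex.Re d / 2).
  rewrite rnormE -(Gnorm _ _ Gxy Gxy')/= -rnormE.
  rewrite (_ : x - x' = (z - x') - (z - x)); last by rewrite opprB [RHS]addrC addrA subrK.
  rewrite (le_lt_trans (ler_normB _ _))// !rnormE -rmorphD -dE ltcR; lra.
have approx d : 0 < d -> exists x y, [/\ G (x, y), rnorm (z - x) < d & rnorm (w - y) < d].
  move=> d0; have dC0 : 0 < d%:C%C :> C by rewrite ltcR.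
  have F1 : F [set y | exists x, G (x, y) /\ rnorm (z - x) < d] by exists d.
  have F2 : F (ball w d%:C%C) by apply: (Fw); exact: nbhsx_ballx.
  have /filter_ex[y [[x [Gxy zx]]]] := @filterI _ F FF _ _ F1 F2.
  by rewrite -ball_normE /= rnorm_lt => wy; exists x, y.
have appr a b : (forall u, G u -> hdot u.1 a + hdot u.2 b = 0) ->
    hdot z a + hdot w b = 0.
  move=> ab; apply: hdot_approx => d /approx[x [y [Gxy zx wy]]].
  by exists x, y; split=> //; exact: (ab _ Gxy).
have Qzw a b : (forall u, G u -> Q u (a, b)) -> Q (z, w) (a, b).
  move=> h1; split=> /=.
  - have := appr a (- b); rewrite -scaleN1r hdotZr rmorphN rmorph1 mulN1r.
    move=> h2; apply/subr0_eq/h2 => u /h1[/= -> _ _].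
    by rewrite hdotZr rmorphN rmorph1 mulN1r subrr.
  - have := appr b 0; rewrite !hdot0r addr0; apply=> u /h1[/= _ -> _].
    by rewrite hdot0r addr0.
  - have := appr 0 a; rewrite !hdot0r add0r; apply=> u /h1[/= _ _ ->].
    by rewrite hdot0r addr0.
have QG u : G u -> Q (z, w) u.
  by case: u => a b Gab; apply: Qzw => u Gu; exact: GQ.
(* Membership in the range of [e] is restated through inner products so that [appr] can carry it to
   the limit. *)
have fixe (x : H) : (forall k, hdot x (e k - k) = 0) -> e x = x.
  move=> hx; apply/subr0_eq/hdot_eq0.
  by rewrite {1}hdotBl cstar_dot es -hdotBr.
exists (z, w); last by move=> [x y] Gxy; apply: zorthC; exists y.
apply: (Gmax) => //; last first.
  by apply: Qzw => u Gu; apply: (QC); exact: QG.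
split=> /=; apply: fixe => k.
  have := appr (e k - k) 0; rewrite hdot0r addr0; apply=> u /GK[eu _].
  by rewrite hdot0r addr0 hdotBr -{1}es -cstar_dot eu subrr.
have := appr 0 (e k - k); rewrite hdot0r add0r; apply=> u /GK[_ eu].
by rewrite hdot0r add0r hdotBr -{1}es -cstar_dot eu subrr.
Unshelve. all: by end_near. Qed.

End HalvingGraph.

Section Halving.
Context {R : realType} {H : hilbertType R}.
Implicit Types (x y z h k : H) (t : R).
Local Notation C := R[i].

(* e - v^* v - v v^* has rank at most one: two orthogonal vectors in its range
   would extend the maximal partial isometry v. *)
Lemma halving (e : bop H) : is_projection e -> exists v : bop H,
  [/\ cmul e v = v, cmul v e = v, cmul v v = 0,
      cmul v (cmul (cstar v) v) = v &
      forall r, r = e - cmul (cstar v) v - cmul v (cstar v) ->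
      forall g h, hdot (r g) (r h) = 0 -> r g = 0 \/ r h = 0].
Proof.
move=> pe; have [ee es] := pe.
have [G [GL GK GQ Gmax Gproj]] := halving_graph pe.
(* [c h] is the point of the graph above the projection of [h] onto the domain, so its second
   coordinate extends the partial isometry by zero. *)
have /choice[c cP] : forall h, exists u, G u /\ forall v, G v -> hdot (h - u.1) v.1 = 0.
  by move=> h; have [u] := Gproj h; exists u.
have GN u v : G u -> G v -> G (u - v).
  by move=> Gu Gv; have := GL (-1) _ _ Gv Gu; rewrite scaleN1r addrC.
have [g0 Gg0 _] := Gproj 0.
have G0 : G 0 by rewrite -(subrr g0); exact: GN.
have G10 u : G u -> u.1 = 0 -> u = 0.
  move=> Gu u1; have [q _] := GQ _ _ Gu Gu.
  move: q; rewrite u1 hdot0l => /esym/hdot_eq0 u2.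
  by case: u u1 u2 {Gu} => a b /= -> ->.
have cE h u : G u -> (forall v, G v -> hdot (h - u.1) v.1 = 0) -> c h = u.
  move=> Gu uh; have [Gc ch] := cP h.
  apply/subr0_eq/G10; first exact: GN.
  apply: hdot_eq0; have Gcu := GN _ _ Gc Gu.
  rewrite -[X in hdot X _](_ : (h - u.1) - (h - (c h).1) = _); last first.
    by rewrite opprB addrC addrA subrK.
  by rewrite hdotBl uh// ch// subrr.
have cG u : G u -> c u.1 = u by move=> Gu; apply: cE => // v _; rewrite subrr hdot0l.
have clin (a : C) x y : c (a *: x + y) = a *: c x + c y.
  have [Gx hx] := cP x; have [Gy hy] := cP y.
  apply: cE => [|v Gv]; first exact: GL.
  rewrite /= opprD addrACA -scalerBr hdotDl hdotZl hx// hy//.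
  by rewrite mulr0 addr0.
have cdot x u : G u -> hdot x u.1 = hdot (c x).1 u.1.
  move=> Gu; apply/subr0_eq; rewrite -hdotBl.
  by have [_] := cP x; apply.
have cnorm h : `|(c h).2| <= `|h|.
  have [Gc ch] := cP h; have [q _] := GQ _ _ Gc Gc.
  rewrite -(hdot_eq_norm q); have [->|n0] := eqVneq (c h).1 0; first by rewrite normr0.
  rewrite -(@ler_pM2r _ `|(c h).1|) ?normr_gt0// -expr2 -hdot_norm.
  rewrite -cdot// -[leLHS]ger0_norm ?hdot_CS// cdot// hdot_norm exprn_ge0//.
have vP : (fun h => (c h).2) \in @bounded_linear R H.
  apply/asboolP; split=> [a x y|]; first by rewrite clin.
  by exists 1 => x; rewrite mul1r.
pose v := Bop vP.
have vE x : v x = (c x).2 by [].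
have vG u : G u -> v u.1 = u.2 by move=> Gu; rewrite vE cG.
have vsv h : cstar v (v h) = (c h).1.
  apply: hdot_inj => k; rewrite -cstar_dot.
  have [Gc _] := cP h; have [Gk _] := cP k.
  by rewrite (cdot k)// !vE; have [-> _] := GQ _ _ Gk Gc.
have vv : cmul v v = 0.
  apply: bopP => h; rewrite cmulE !vE (cE _ 0)// => u Gu.
  rewrite subr0; have [Gc _] := cP h.
  by apply: hdot_eq0C; have [_] := GQ _ _ Gu Gc.
have ev : cmul e v = v.
  by apply: bopP => h; rewrite cmulE !vE; have [/GK[]] := cP h.
have ve : cmul v e = v.
  apply: bopP => h; rewrite cmulE !vE; have [Gc ch] := cP h.
  congr (_.2); apply: (cE) => // u Gu.
  by rewrite hdotBl cstar_dot es (GK _ Gu).1 -hdotBl ch.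
have vvv : cmul v (cmul (cstar v) v) = v.
  apply: bopP => h; rewrite !cmulE vsv; apply: vG.
  by have [] := cP h.
exists v; split=> // r rE g h rgh.
have svs : cmul (cstar v) (cstar v) = 0 by rewrite -cstarM vv cstar0.
have svv : cmul (cstar v) (cmul v (cstar v)) = cstar v.
  by rewrite -[in RHS]vvv !cstarM cstarK cmulA.
have er : cmul e r = r.
  have esv : cmul e (cstar v) = cstar v by rewrite -[in LHS]es -cstarM ve.
  by rewrite rE !cmulDr !cmulNr ee !cmulA esv ev.
have vr : cmul v r = 0.
  by rewrite rE !cmulDr !cmulNr ve vvv cmulA vv cmul0l subrr subr0.
have svr : cmul (cstar v) r = 0.
  have sve : cmul (cstar v) e = cstar v by rewrite -[in LHS]es -cstarM ev.
  by rewrite rE !cmulDr !cmulNr sve svv cmulA svs cmul0l subr0 subrr.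
have rG x u : G u -> hdot (r x) u.1 = 0 /\ hdot (r x) u.2 = 0.
  move=> Gu; split; last first.
    rewrite -vG// -[v]cstarK -cstar_dot -cmulE svr; exact: hdot0l.
  have /(congr1 (fun f : bop H => f x)) := vr; rewrite cmulE => vrx.
  rewrite cdot// -vsv vrx bop0 hdot0l//.
(* Scaling each vector by the norm of the other gives equal lengths without a division. The
   resulting pair enters [G] by maximality, while [r g] is orthogonal to all first coordinates of
   [G]. *)
pose a := `|r h|; pose b := `|r g|.
have aJ : a^* = a by apply: conj_Creal; rewrite ger0_real//; exact: normr_ge0.
have bJ : b^* = b by apply: conj_Creal; rewrite ger0_real//; exact: normr_ge0.
have Ggh : G (a *: r g, b *: r h).
  apply: Gmax; rewrite ?bopZ -?cmulE ?er//.
  - by rewrite !hdotZl !hdotZr !hdot_norm aJ bJ -/a -/b; ring.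
  - by rewrite hdotZl hdotZr rgh !mulr0.
  by move=> u Gu; rewrite !hdotZl !(rG _ _ Gu).1 !(rG _ _ Gu).2 !mulr0.
have := (rG g _ Ggh).1 => /=; rewrite hdotZr aJ hdot_norm => /eqP.
rewrite /a mulf_eq0 sqrf_eq0 !normr_eq0 => /orP[]/eqP; by [right|left].
Qed.

Lemma projection_grid (e : bop H) : is_projection e -> rank_ge2 e ->
  exists p s : option bool -> bop H, exists j, grid e p s j.
Proof.
move=> pe rk; have [ee es] := pe.
have [v [ev ve vv vvv /(_ _ erefl)]] := halving pe; set r := _ - _ - _ => rk1.
pose p1 := cmul (cstar v) v; pose p2 := cmul v (cstar v).
have svs : cmul (cstar v) (cstar v) = 0 by rewrite -cstarM vv cstar0.
have svv : cmul (cstar v) (cmul v (cstar v)) = cstar v.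
  by rewrite -[in RHS]vvv !cstarM cstarK cmulA.
have esv : cmul e (cstar v) = cstar v by rewrite -[in LHS]es -cstarM ve.
have sve : cmul (cstar v) e = cstar v by rewrite -[in LHS]es -cstarM ev.
have p1s : cstar p1 = p1 by rewrite cstarM cstarK.
have p2s : cstar p2 = p2 by rewrite cstarM cstarK.
have p11 : cmul p1 p1 = p1 by rewrite -cmulA vvv.
have p22 : cmul p2 p2 = p2 by rewrite -cmulA svv.
have p12 : cmul p1 p2 = 0 by rewrite /p1 -cmulA (cmulA v) vv cmul0l cmul0r.
have p21 : cmul p2 p1 = 0 by rewrite -p2s -p1s -cstarM p12 cstar0.
have ep1 : cmul e p1 = p1 by rewrite cmulA esv.
have p1e : cmul p1 e = p1 by rewrite -cmulA ve.
have ep2 : cmul e p2 = p2 by rewrite cmulA ev.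
have p2e : cmul p2 e = p2 by rewrite -cmulA sve.
have rs : cstar r = r by rewrite /r !cstarD !cstarN es p1s p2s.
have p1r : cmul p1 r = 0 by rewrite /r !cmulDr !cmulNr p1e p11 p12 subrr subr0.
have p2r : cmul p2 r = 0 by rewrite /r !cmulDr !cmulNr p2e p21 p22 subr0 subrr.
have rp1 : cmul r p1 = 0 by rewrite -rs -p1s -cstarM p1r cstar0.
have rp2 : cmul r p2 = 0 by rewrite -rs -p2s -cstarM p2r cstar0.
have rr : cmul r r = r.
  rewrite {2}/r !cmulDr !cmulNr rp1 rp2 !subr0.
  by rewrite -[LHS]cstarK cstarM rs es {2}/r !cmulDr !cmulNr ee ep1 ep2 rs.
(* The rank hypothesis enters here: if [p1] is zero, then [r] is [e], which would have rank at most
   one. *)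
have p1r0 : p1 = 0 -> r = 0.
  move=> p10; have v0 : v = 0 by rewrite -vvv -/p1 p10 cmul0r.
  have re : r = e by rewrite /r v0 !cmul0l !cmul0r !subr0.
  exfalso; have [x [y xy]] := rk.
  have ex : hdot (e x) (e x) != 0.
    apply/eqP => /hdot_eq0 ex0; have [] := xy 1 0.
      by rewrite ex0 scaler0 scale0r addr0.
    by move/eqP; rewrite oner_eq0.
  pose t := hdot (e y) (e x) / hdot (e x) (e x).
  have [] := rk1 (y - t *: x) x.
  - by rewrite re bopD bopN bopZ hdotBl hdotZl mulfVK// subrr.
  - rewrite re bopD bopN bopZ => eyx; have [] := xy (- t) 1.
      by rewrite scale1r addrC scaleNr.
    by move=> _ /eqP; rewrite oner_eq0.
  by rewrite re => ex0; rewrite ex0 hdot0l eqxx in ex.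
have [w [pw wr ww]] := rank1_link (conj rr rs) (conj p11 p1s) rk1 p1r0.
(* The indices [Some true] and [Some false] stand for the two equivalent projections, exchanged by
   [v] and its adjoint; [None] stands for the remainder, possibly zero, which is linked into the
   first. *)
exists (fun i => match i with None => r | Some true => p1 | Some false => p2 end).
exists (fun i => match i with None => w | Some true => v | Some false => cstar v end).
exists (fun i => match i with None => Some true | Some b => Some (~~ b) end).
split.
- by move=> [[]|].
- by move=> [[]|].
- by move=> [[]|].
- by move=> [[]|] [[]|].
- rewrite (bigD1 None)// (bigD1 (Some true))// (bigD1 (Some false))//= big1.
    by rewrite addr0 (addrC p1) addrA !subrK.
  by move=> [[]|].
- move=> [[]|] //=; first by rewrite -[in RHS]vvv cmulA.
  by rewrite -[in RHS]svv cmulA.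
- by move=> [[]|] //=.
- by move=> [[]|] //=; rewrite cstarK.
Qed.

End Halving.

(** * Transposition and words *)

Section Closedness.
Context {K : numFieldType} {V W : normedModType K}.

Lemma closed_lipschitz_ker (f : V -> W) (M : K) : 0 <= M ->
  (forall x y, f (x - y) = f x - f y) -> (forall x, `|f x| <= M * `|x|) ->
  closed [set x | f x = 0].
Proof.
move=> M0 fB fM x fx; apply/eqP; rewrite -normr_le0.
apply/ler_addgt0Pr => d d0; rewrite add0r.
have M1 : 0 < 1 + M by rewrite ltr_wpDr.
have [y [/= fy]] := fx _ (nbhsx_ballx x _ (divr_gt0 d0 M1)).
rewrite -ball_normE /= => xy; rewrite -[f x]subr0 -fy -fB (le_trans (fM _))//.
rewrite (le_trans (ler_wpM2l M0 (ltW xy)))// mulrCA ger_pMr//.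
by rewrite ler_pdivrMr// mul1r lerDr.
Qed.

End Closedness.

Section Transposition.
Context {R : realType} {H : hilbertType R} (J : conjugation H).
Local Notation C := R[i].
Implicit Types (x y : H) (a b c : bop H).

Lemma conjD x y : J (x + y) = J x + J y.
Proof. by have := conj_antilinear J 1 x y; rewrite rmorph1 !scale1r. Qed.
Lemma conj0 : J 0 = 0.
Proof. by apply: (addIr (J 0)); rewrite -conjD !add0r. Qed.
Lemma conjZ (k : C) x : J (k *: x) = k^* *: J x.
Proof. by have := conj_antilinear J k x 0; rewrite conj0 !addr0. Qed.

Lemma conj_rdot x y : rdot (J x) (J y) = rdot x y.
Proof.
have rn u : rdot (J u) (J u) = rdot u u.
  by rewrite !rdot_norm /rnorm conj_isometry.
have := rn (x + y); rewrite conjD !(rdotDl, rdotDr) !rn.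
rewrite (rdotC y x) (rdotC (J y)); lra.
Qed.

(** Polarization of the norm gives the real part; the imaginary part changes sign because J
    anticommutes with multiplication by i. *)
Lemma conj_dot x y : hdot (J x) (J y) = hdot y x.
Proof.
have Ji : 'i *: J y = - J ('i *: y) by rewrite conjZ conjCi scaleNr opprK.
rewrite hdot_rdot Ji rdotNr !conj_rdot (hdot_rdot y x) rdotC.
by rewrite (rdot_ir y) (rdotC ('i *: y)).
Qed.

Lemma transpE a x : transp J a x = J (cstar a (J x)). Proof. by []. Qed.

Lemma transp_star a : cstar (transp J a) = transp J (cstar a).
Proof.
apply: bopP => x; apply: hdot_inj => y.
rewrite -cstar_dot !transpE cstarK -[in LHS](conj_involutive J x) conj_dot.
by rewrite -cstar_dot -[in RHS](conj_involutive J y) conj_dot.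
Qed.

Lemma transpK : involutive (transp J).
Proof.
move=> a; apply: bopP => x.
by rewrite transpE transp_star transpE cstarK !conj_involutive.
Qed.

Lemma transp_linear : linear (transp J).
Proof.
move=> k a b; apply: bopP => x; rewrite bopDE bopZE !transpE cstar_antilinear.
by rewrite bopDE bopZE conjD conjZ conjCK.
Qed.

Lemma transpM a b : transp J (cmul a b) = cmul (transp J b) (transp J a).
Proof.
apply: bopP => x; rewrite cmulE !transpE cstarM cmulE.
by rewrite conj_involutive.
Qed.

Lemma transpD a b : transp J (a + b) = transp J a + transp J b.
Proof. by have := transp_linear 1 a b; rewrite !scale1r. Qed.
Lemma transp0 : transp J 0 = 0.
Proof. by apply: (addIr (transp J 0)); rewrite -transpD !add0r. Qed.
Lemma transpZ (k : C) a : transp J (k *: a) = k *: transp J a.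
Proof. by have := transp_linear k a 0; rewrite transp0 !addr0. Qed.
Lemma transp_sum (I : finType) (F : I -> bop H) :
  transp J (\sum_i F i) = \sum_i transp J (F i).
Proof. by apply: big_morph => [x y|]; rewrite ?transpD ?transp0. Qed.

Lemma transp_tro a b c :
  transp J (tro_prod a b c) = tro_prod (transp J c) (transp J b) (transp J a).
Proof. by rewrite /tro_prod !transpM -transp_star cmulA. Qed.

Lemma transp_jc a b c :
  transp J (jc_prod a b c) = jc_prod (transp J a) (transp J b) (transp J c).
Proof. by rewrite /jc_prod transpZ transpD !transp_tro addrC. Qed.

End Transposition.

Section OddWords.
Context {R : realType} {A : cstarType R}.
Implicit Types a b : nat -> A.

Lemma eq_odd_word a b n : (forall i, (i <= n.*2)%N -> a i = b i) ->
  odd_word a n = odd_word b n.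
Proof.
elim: n => [|n IHn] ab /=; first exact: ab.
rewrite IHn => [|i iN]; last by apply: ab; rewrite doubleS ltnW// ltnW.
by rewrite !ab// doubleS.
Qed.

(** Words grow on the right by definition; reversal requires peeling letters off on the left. *)
Lemma odd_wordSl a n :
  odd_word a n.+1 = tro_prod (a 0%N) (a 1%N) (odd_word (fun i => a i.+2) n).
Proof.
elim: n => [//|n IHn]; rewrite [LHS]/= -/(odd_word a n.+1) IHn.
by rewrite /= /tro_prod !cmulA.
Qed.

Lemma odd_word_closed (T : set A) a n : closed_under tro_prod T ->
  (forall i, (i <= n.*2)%N -> T (a i)) -> T (odd_word a n).
Proof.
move=> TT; elim: n => [|n IHn] Ta /=; first exact: Ta.
apply: TT; [apply: IHn => i iN|exact: Ta|exact: Ta].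
by apply: Ta; rewrite doubleS ltnW// ltnW.
Qed.

Lemma odd_word_hom {B : cstarType R} (T : set A) (U : set B) (g : A -> B) a n :
  closed_under tro_prod T -> TRO_hom T U g -> (forall i, T (a i)) ->
  g (odd_word a n) = odd_word (g \o a) n.
Proof.
move=> TT [_ _ gM] Ta; elim: n => [//|n IHn] /=.
by rewrite gM// ?IHn//; exact: odd_word_closed.
Qed.

End OddWords.

Lemma transp_odd_word (R : realType) (H : hilbertType R) (J : conjugation H)
    (x : nat -> bop H) n :
  transp J (odd_word x n) = odd_word (fun i => transp J (x (n.*2 - i)%N)) n.
Proof.
elim: n => [//|n IHn]; rewrite [RHS]odd_wordSl /= transp_tro IHn.
by congr (tro_prod _ _ _); rewrite doubleS ?subn0 ?subn1.
Qed.

(** * The universal TRO *)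

Lemma cstar_star_ring (R : realType) (A : cstarType R) :
  star_ring (@cmul R A) (@cstar R A).
Proof.
split.
- exact: cmulA.
- by move=> a b c; exact: cmulDl.
- by move=> a b c; exact: cmulDr.
- exact: cstarK.
- exact: cstarD.
- exact: cstarM.
- exact: double_eq0.
Qed.

Section Subspaces.
Context {R : realType} {A B : cstarType R}.
Implicit Types S : set A.

Lemma subspaceD S x y : is_subspace S -> S x -> S y -> S (x + y).
Proof. by move=> [_ SL] Sx Sy; have := SL 1 _ _ Sx Sy; rewrite scale1r. Qed.
Lemma subspaceZ S k x : is_subspace S -> S x -> S (k *: x).
Proof. by move=> [S0 SL] Sx; have := SL k _ _ Sx S0; rewrite addr0. Qed.
Lemma subspace_sum S (I : finType) (F : I -> A) : is_subspace S ->
  (forall i, S (F i)) -> S (\sum_i F i).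
Proof.
move=> SS SF; elim/big_rec : _ => [|i x _ Sx]; first by case: SS.
exact: subspaceD.
Qed.

Lemma linear_onD S (f : A -> B) x y : linear_on S f -> S x -> S y ->
  f (x + y) = f x + f y.
Proof. by move=> fL Sx Sy; have := fL 1 _ _ Sx Sy; rewrite !scale1r. Qed.
Lemma linear_on0 S (f : A -> B) : is_subspace S -> linear_on S f -> f 0 = 0.
Proof.
move=> [S0 _] fL; apply: (addIr (f 0)).
by rewrite -(linear_onD fL)// !add0r.
Qed.
Lemma linear_on_sum S (I : finType) (f : A -> B) (F : I -> A) : is_subspace S ->
  linear_on S f -> (forall i, S (F i)) -> f (\sum_i F i) = \sum_i f (F i).
Proof.
move=> SS fL SF; suff : S (\sum_i F i) /\ f (\sum_i F i) = \sum_i f (F i) by case.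
elim/big_rec2 : _ => [|i x y _ [Sy fy]].
  by split; [case: SS|exact: linear_on0 fL].
by split; [exact: subspaceD|rewrite (linear_onD fL)// fy].
Qed.

Lemma TRO_jc S : is_subspace S -> closed_under tro_prod S -> closed_under jc_prod S.
Proof.
move=> SS ST a b c Sa Sb Sc; apply: subspaceZ => //.
by apply: subspaceD => //; exact: ST.
Qed.

End Subspaces.

(** * The left ideal B(H)e and its universal TRO *)

Section LeftIdeal.
Context {R : realType} {H : hilbertType R}.
Variables (e : bop H) (pe : is_projection e).
Let E : set (bop H) := [set cmul x e | x in [set: bop H]].

Lemma left_idealP x : E x <-> cmul x e = x.
Proof.
split=> [[y _ <-]|xe]; last by exists x.
by rewrite -cmulA pe.1.
Qed.

Lemma left_ideal_subspace : is_subspace E.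
Proof.
split=> [|k x y /left_idealP Ex /left_idealP Ey]; apply/left_idealP.
  by rewrite cmul0l.
by rewrite cmulDl cmulZl Ex Ey.
Qed.

Lemma left_ideal_tro : closed_under tro_prod E.
Proof.
move=> a b c _ _ /left_idealP Ec; apply/left_idealP.
by rewrite /tro_prod -cmulA Ec.
Qed.

Lemma left_ideal_JCtriple : is_JCtriple E.
Proof.
split; [|exact: left_ideal_subspace|exact: TRO_jc left_ideal_subspace left_ideal_tro].
rewrite (_ : E = [set x | cmul x e - x = 0]); last first.
  apply/seteqP; split=> x /=; first by move/left_idealP => ->; rewrite subrr.
  by move/subr0_eq => /left_idealP.
apply: (@closed_lipschitz_ker _ _ _ _ (`|e| + 1)).
- by rewrite addr_ge0.
- by move=> x y; rewrite cmulDl cmulNl opprD addrACA -opprD.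
move=> x; rewrite (le_trans (ler_normB _ _))// mulrDl mul1r lerD//.
by rewrite mulrC cnormM.
Qed.

Section WithTransposition.
Variable J : conjugation H.
Local Notation t := (transp J).
Let T : set (bop H * bop H) := E `*` (t @` E).
Let alpha (x : bop H) : bop H * bop H := (x, t x).

Lemma dual_sumP u : T u <-> E u.1 /\ E (t u.2).
Proof.
split=> [[Eu [x Ex xu]]|[E1 E2]].
  by split=> //; rewrite -xu transpK.
by split=> //; exists (t u.2); rewrite ?transpK.
Qed.

Lemma dual_sum_subspace : is_subspace T.
Proof.
have ES := left_ideal_subspace.
split=> [|k u v /dual_sumP[u1 u2] /dual_sumP[v1 v2]]; apply/dual_sumP.
  by rewrite /= transp0; split; case: ES.
by split; rewrite /= ?transp_linear; exact: ES.2.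
Qed.

Lemma dual_sum_TRO : is_TRO T.
Proof.
split; [|exact: dual_sum_subspace|]; last first.
  move=> a b c /dual_sumP[a1 a2] /dual_sumP[b1 b2] /dual_sumP[c1 c2].
  apply/dual_sumP; split; first exact: (left_ideal_tro a1 b1 c1).
  by rewrite [t _]transp_tro; exact: left_ideal_tro.
rewrite (_ : T = [set u | cmul u.1 e - u.1 = 0] `&`
                 [set u | cmul (t e) u.2 - u.2 = 0]); last first.
  apply/seteqP; split=> [u /dual_sumP[/left_idealP u1 /left_idealP u2]|u [h1 h2]].
    rewrite /= u1 subrr; split=> //=.
    by rewrite -{1}(transpK J u.2) -transpM u2 transpK subrr.
  apply/dual_sumP; split; apply/left_idealP; first exact/subr0_eq.
  by rewrite -[e](transpK J) -transpM (subr0_eq h2).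
have le12 (u : bop H * bop H) : `|u.1| <= `|u| /\ `|u.2| <= `|u|.
  rewrite prod_normE /=.
  have /orP[h|h] : (`|u.1| <= `|u.2|) || (`|u.2| <= `|u.1|).
    by rewrite real_leVge ?ger0_real.
  - by rewrite max_r.
  - by rewrite max_l.
apply: closedI.
  apply: (@closed_lipschitz_ker _ _ _ _ (`|e| + 1)).
  - by rewrite addr_ge0.
  - by move=> x y; rewrite cmulDl cmulNl opprD addrACA -opprD.
  move=> x; have [x1 _] := le12 x.
  rewrite (le_trans (ler_normB _ _))// mulrDl mul1r lerD//.
  by rewrite (le_trans (cnormM _ _))// mulrC ler_wpM2l.
apply: (@closed_lipschitz_ker _ _ _ _ (`|t e| + 1)).
- by rewrite addr_ge0.
- by move=> x y; rewrite cmulDr cmulNr opprD addrACA -opprD.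
move=> x; have [_ x2] := le12 x.
rewrite (le_trans (ler_normB _ _))// mulrDl mul1r lerD//.
by rewrite (le_trans (cnormM _ _))// ler_wpM2l.
Qed.

Lemma dual_sum_hom : triple_hom E T alpha.
Proof.
split.
- by move=> x Ex; apply/dual_sumP; rewrite /= transpK.
- by move=> k x y _ _; rewrite /alpha transp_linear.
- by move=> a b c _ _ _; rewrite /alpha transp_jc.
Qed.

Variables (I : finType) (p s : I -> bop H) (j : I -> I).
Hypothesis G : grid e p s j.

Lemma grid_memp i : E (p i).
Proof. exact/left_idealP/(gridpe G). Qed.
Lemma grid_mems i : E (s i).
Proof. exact/left_idealP/(gridse G). Qed.
Lemma grid_memM x i : E (cmul x (cstar (s i))).
Proof.
apply/left_idealP/(gridE G (i := j i)).
by rewrite -cmulA (grid_starr G).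
Qed.

Lemma grid_word0 x i : tro_prod (s i) (p (j i)) (cmul x (cstar (s i))) = 0.
Proof.
rewrite /tro_prod (grid_star G) -(grid_r G i) -(cmulA (s i)).
rewrite (grid_orth G) ?cmul0r ?cmul0l//.
by rewrite eq_sym (grid_neq G).
Qed.

Lemma grid_word1 x i :
  tro_prod (cmul x (cstar (s i))) (p (j i)) (s i) = cmul x (p i).
Proof. by rewrite /tro_prod (grid_star G) -!cmulA (grid_l G) (grid_ss G). Qed.

(** The second coordinate of each word is the transpose of the reversed word, which is zero by
    [grid_word0]. *)
Lemma alpha_wordl x : E x -> (x, 0) =
  \sum_i tro_prod (alpha (cmul x (cstar (s i)))) (alpha (p (j i))) (alpha (s i)).
Proof.
move=> /left_idealP Ex; rewrite {1}(grid_split G Ex).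
transitivity (\sum_i (cmul x (p i), (0 : bop H))).
  elim/big_rec2 : _ => [//|i [a b] y _ <-]; by congr pair; rewrite /= addr0.
apply: eq_bigr => i _; congr pair; first by rewrite [RHS]grid_word1.
by rewrite -[LHS](transp0 J) -(grid_word0 x i) transp_tro.
Qed.

Lemma alpha_wordr x : E x -> (0, t x) =
  \sum_i tro_prod (alpha (s i)) (alpha (p (j i))) (alpha (cmul x (cstar (s i)))).
Proof.
move=> /left_idealP Ex; rewrite {1}(grid_split G Ex) transp_sum.
transitivity (\sum_i ((0 : bop H), t (cmul x (p i)))).
  elim/big_rec2 : _ => [//|i [a b] y _ <-]; by congr pair; rewrite /= addr0.
apply: eq_bigr => i _; congr pair; first by rewrite [RHS]grid_word0.
by rewrite -[in LHS]grid_word1 transp_tro.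
Qed.

Lemma dual_sum_split u : T u -> u = (u.1, 0) + (0, t (t u.2)).
Proof. by case: u => a b _; rewrite transpK; congr pair; rewrite /= ?addr0 ?add0r. Qed.

Lemma dual_sum_generated : smallest is_TRO (alpha @` E) = T.
Proof.
apply/seteqP; split=> [u|u Tu].
  apply; split; first exact: dual_sum_TRO.
  by move=> _ [x Ex <-]; case: dual_sum_hom => + _ _; apply.
move=> U [[_ US UT] EU]; have [E1 E2] := (dual_sumP u).1 Tu.
have Ua x : E x -> U (alpha x) by move=> Ex; apply: EU; exists x.
rewrite (dual_sum_split Tu) alpha_wordl// alpha_wordr//.
apply: (subspaceD US); apply: (subspace_sum US) => i; apply: UT;
  by apply: Ua; first [exact: grid_memM|exact: grid_memp|exact: grid_mems].
Qed.

Section UniversalProperty.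
Variables (B : cstarType R) (U : set B) (f : bop H -> B).
Hypotheses (UT : is_TRO U) (fh : triple_hom E U f).

Let m' a b := @cmul R B b a.
Local Notation phi := (jh_part p s j (@cmul R B) (@cstar R B) f).
Local Notation psi := (jh_part p s j m' (@cstar R B) f).
Let SR := cstar_star_ring B.
Let SR' := star_ring_flip SR.

Lemma triple_hom_jordan : jordan_hom e (@cmul R B) (@cstar R B) f.
Proof.
have [fU fL fJ] := fh; have ES := left_ideal_subspace.
split=> [a b|a b c] /left_idealP Ea /left_idealP Eb.
  exact: (linear_onD fL).
move=> /left_idealP Ec.
have -> : tro_prod a b c + tro_prod c b a = 2 *: jc_prod a b c.
  by rewrite /jc_prod scalerA mulfV ?scale1r ?pnatr_eq0.
rewrite -[_ *: _]addr0 fL; last by case: ES.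
  rewrite (linear_on0 ES fL) addr0 fJ//.
  by rewrite /jc_prod scalerA mulfV ?scale1r ?pnatr_eq0.
exact: (TRO_jc ES left_ideal_tro).
Qed.
Let JF := triple_hom_jordan.
Let JF' := jordan_hom_flip SR JF.

Let phiL : linear_on E phi.
Proof.
move=> k x y Ex Ey; have Exy := left_ideal_subspace.2 k _ _ Ex Ey.
rewrite !(jh_partE G SR JF) -?left_idealP//; have [_ fL _] := fh.
by rewrite fL// cmulDl cmulZl.
Qed.

Let psiL : linear_on E psi.
Proof.
move=> k x y Ex Ey; have Exy := left_ideal_subspace.2 k _ _ Ex Ey.
rewrite !(jh_partE G SR' JF') -?left_idealP//; have [_ fL _] := fh.
by rewrite fL// /m' cmulDr cmulZr.
Qed.

Let psiE x : psi x =
  \sum_i tro_prod (f (s i)) (f (p (j i))) (f (cmul x (cstar (s i)))).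
Proof. by apply: eq_bigr => i _; rewrite /m' cmulA. Qed.

Let g (u : bop H * bop H) : B := phi u.1 + psi (t u.2).

(** Both psi and the transposition reverse products, so their composite preserves them. *)
Lemma dual_sum_extension : TRO_hom T U g.
Proof.
have [_ US UC] := UT; have [fU _ _] := fh.
split.
- move=> u /dual_sumP[E1 E2]; apply: (subspaceD US).
    apply: (subspace_sum US) => i; apply: UC; apply: fU;
    by first [exact: grid_memM|exact: grid_memp|exact: grid_mems].
  rewrite psiE; apply: (subspace_sum US) => i; apply: UC; apply: fU;
  by first [exact: grid_memM|exact: grid_memp|exact: grid_mems].
- move=> k u v /dual_sumP[u1 u2] /dual_sumP[v1 v2].
  by rewrite /g /= transp_linear phiL// psiL// scalerDr addrACA.
move=> a b c /dual_sumP[/left_idealP a1 /left_idealP a2].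
move=> /dual_sumP[/left_idealP b1 /left_idealP b2].
move=> /dual_sumP[/left_idealP c1 /left_idealP c2].
rewrite /g [X in phi X](_ : _ = tro_prod a.1 b.1 c.1)//.
rewrite [X in t X](_ : _ = tro_prod a.2 b.2 c.2)// transp_tro.
rewrite (jh_part_tro G SR JF a1 b1 c1) (jh_part_tro G SR' JF' c2 b2 a2).
rewrite /m' /tro_prod cstarD !(cmulDl, cmulDr).
(* The triple product of the sums expands into eight words; the six mixed ones contain adjacent
   factors from phi and psi and vanish by orthogonality. *)
set a' := t a.2 in a2 *; set b' := t b.2 in b2 *; set c' := t c.2 in c2 *.
rewrite (jh_part_orthr G SR JF a1 b2).
have o1 : cmul (psi a') (cstar (phi b.1)) = 0.
  by rewrite -[LHS]cstarK cstarM cstarK (jh_part_orthr G SR JF b1 a2) cstar0.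
have o2 : cmul (cstar (phi b.1)) (psi c') = 0 := jh_part_orthl G SR JF b1 c2.
have o3 : cmul (cstar (psi b')) (phi c.1) = 0.
  by rewrite -[LHS]cstarK cstarM cstarK (jh_part_orthl G SR JF c1 b2) cstar0.
rewrite o1 !cmul0l -!cmulA o2 o3 !cmul0r !addr0 !add0r.
by [].
Qed.

Lemma dual_sum_extension_alpha x : E x -> g (alpha x) = f x.
Proof.
by move=> /left_idealP Ex; rewrite /g /= transpK -(jh_part_split G SR JF).
Qed.

Lemma dual_sum_extension_unique (h : bop H * bop H -> B) : TRO_hom T U h ->
  (forall x, E x -> h (alpha x) = f x) -> forall u, T u -> h u = g u.
Proof.
move=> [_ hL hM] hf u Tu; have [E1 E2] := (dual_sumP u).1 Tu.
have [alphaT _ _] := dual_sum_hom; have [_ TS TC] := dual_sum_TRO.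
rewrite {1}(dual_sum_split Tu) alpha_wordl// alpha_wordr//.
have Tl i x : T (tro_prod (alpha (cmul x (cstar (s i)))) (alpha (p (j i))) (alpha (s i))).
  by apply: TC; apply: alphaT; first [exact: grid_memM|exact: grid_memp|exact: grid_mems].
have Tr i x : T (tro_prod (alpha (s i)) (alpha (p (j i))) (alpha (cmul x (cstar (s i))))).
  by apply: TC; apply: alphaT; first [exact: grid_memM|exact: grid_memp|exact: grid_mems].
rewrite (linear_onD hL); [|exact: subspace_sum|exact: subspace_sum].
rewrite !(linear_on_sum TS hL)//; congr (_ + _).
  apply: eq_bigr => i _; rewrite hM; try (apply: alphaT;
    by first [exact: grid_memM|exact: grid_memp|exact: grid_mems]).
  rewrite !hf//; by first [exact: grid_memM|exact: grid_memp|exact: grid_mems].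
rewrite psiE; apply: eq_bigr => i _; rewrite hM; try (apply: alphaT;
  by first [exact: grid_memM|exact: grid_memp|exact: grid_mems]).
rewrite !hf//; by first [exact: grid_memM|exact: grid_memp|exact: grid_mems].
Qed.

End UniversalProperty.

Lemma dual_sum_universal : is_universal_TRO E T alpha.
Proof.
split.
- exact: left_ideal_JCtriple.
- exact: dual_sum_TRO.
- exact: dual_sum_hom.
- by move=> x y _ _ [].
- exact: dual_sum_generated.
move=> B U f UT fh; eexists; split; first exact: (dual_sum_extension UT fh).
  by move=> x Ex; exact: (dual_sum_extension_alpha fh).
by move=> h hh hf u Tu; exact: (dual_sum_extension_unique hh hf).
Qed.

End WithTransposition.

(** If w is a word in elements of E and w' its reverse, the same word in their images under [alpha]
    is (w, w'^t) and the reversed one is (w', w^t). Their sum is [alpha] of w + w', and the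
    extension [g] carries this to any other universal TRO. *)
Lemma reversible_universal (J : conjugation H) :
  is_universal_TRO E (E `*` (transp J @` E)) (fun x => (x, transp J x)) ->
  universally_reversible E.
Proof.
set T := E `*` _; set alpha := fun x => _ => univ B T' alpha' univ' n a n0 aE.
have ES := left_ideal_subspace; have EC := left_ideal_tro.
have [alphaT _ _] := universal_hom univ.
have [_ _ TC] := universal_TRO univ.
have [g [gh galpha _]] := universal_property univ (universal_TRO univ')
  (universal_hom univ').
have [_ gL gM] := gh.
(* Past [n.*2] nothing is known about [a], so [x] takes the value 0 there; this keeps all its values
   in E, as [odd_word_hom] requires. *)
have /choice[x xP] : forall i, exists y, E y /\ ((i <= n.*2)%N -> alpha' y = a i).
  move=> i; have [iN|iN] := boolP (i <= n.*2)%N; last by exists 0; split=> //; case: ES.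
  by have [y Ey yi] := aE _ iN; exists y.
have xE i : E (x i) by case: (xP i).
have word (y : nat -> bop H) : (forall i, E (y i)) ->
    odd_word (alpha' \o y) n = g (odd_word (alpha \o y) n).
  move=> Ey; rewrite (odd_word_hom _ TC gh) => [|i]; last exact: alphaT.
  by apply: eq_odd_word => i _ /=; rewrite galpha.
pose rx i := x (n.*2 - i)%N.
have alpha_word (y : nat -> bop H) : odd_word (alpha \o y) n =
    (odd_word y n, transp J (odd_word (fun i => y (n.*2 - i)%N) n)).
  rewrite transp_odd_word (@eq_odd_word _ _ (fun i => transp J (y (n.*2 - (n.*2 - i))%N))
    (fun i => transp J (y i))); last by move=> i iN; rewrite subKn.
  by elim: n {n0 aE xP word rx} => [//|n IHn] /=; rewrite IHn.
have T_word (y : nat -> bop H) : (forall i, E (y i)) -> T (odd_word (alpha \o y) n).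
  by move=> Ey; apply: odd_word_closed => // i _; exact: alphaT.
exists (odd_word x n + odd_word rx n).
  by apply: (subspaceD ES); apply: odd_word_closed => // i _; exact: xE.
have -> : odd_word a n = odd_word (alpha' \o x) n.
  by apply: eq_odd_word => i iN; case: (xP i) => _ /= ->.
have -> : odd_word (fun i => a (n.*2 - i)%N) n = odd_word (alpha' \o rx) n.
  by apply: eq_odd_word => i iN; case: (xP (n.*2 - i)%N) => _ /= ->//; rewrite leq_subr.
have rxE i : E (rx i) by exact: xE.
rewrite !word// -(linear_onD gL (T_word _ xE) (T_word _ rxE)).
rewrite -galpha; last first.
  by apply: (subspaceD ES); apply: odd_word_closed => // i _; exact: xE.
congr (g _); rewrite !alpha_word /alpha transpD; congr pair; rewrite addrC.
congr (_ + _); congr (transp J _).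
by apply: eq_odd_word => i iN; rewrite /rx subKn.
Qed.

End LeftIdeal.

Theorem theorem5p4 (R : realType) (H : hilbertType R) (e : bop H) :
  is_projection e -> rank_ge2 e ->
  let E : set (bop H) := [set cmul x e | x in [set: bop H]] in
  [/\ universally_reversible E,
      forall J : conjugation H,
        is_universal_TRO E (E `*` (transp J @` E)) (fun x => (x, transp J x)) &
      exists J : conjugation H, transp J e = e].
Proof.
move=> pe rk E; have [p [s [j G]]] := projection_grid pe rk.
have univ J := dual_sum_universal pe J G.
have [J Je] := conjugation_exists pe.
split; [exact: (reversible_universal pe (univ J))|exact: univ|exists J].
apply: bopP => x; rewrite transpE pe.2 Je.
by rewrite conj_involutive.
Qed.
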